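(* Let $u\in C^2(\Omega)\cap C^1(\overline{\Omega})$ be a strictly convex solution of $$\det[D^2u]=\psi^n(x)\ \text{ in }\Omega,\qquad u=0\ \text{ on }\Gamma^+,\qquad u_\nu=\gamma_0u+\phi(x)\ \text{ on }\Gamma^-$$ in the annular domain $\Omega$. Then there are constants $C_0,C_1$ depending on $n,\Omega,\psi$ and $\phi$ such that $$\sup_{\overline\Omega}|u|\le C_0,\qquad \|u\|_{C^1(\overline\Omega)}\le C_1 .$$
   Context: $\Omega\subset\mathbb{R}^n$ is an annular domain: $\partial\Omega=\Gamma^+\cup\Gamma^-$, where $\Gamma^+$ is the exterior and $\Gamma^-$ the interior boundary component, and $\Gamma^+,\Gamma^-$ are disjoint, smooth, closed, strictly convex hypersurfaces enclosing the origin. $\nu$ is the unit normal field on $\Gamma^-$ pointing into $\Omega$, and $u_\nu$ is the derivative of $u$ in the direction $\nu$. $\gamma_0\ge 0$ is a given constant; $\psi>0$ and $\phi$ are smooth functions on $\Omega$ and $\Gamma^-$ respectively. A strictly convex function is one whose Hessian $D^2u$ is positive definite. *)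

(* Defs.v *)
From HB Require Import structures.
From mathcomp Require Import all_boot all_order all_algebra.
From mathcomp Require Import all_classical all_reals all_analysis.

Set Implicit Arguments.
Unset Strict Implicit.
Unset Printing Implicit Defensive.

Import Order.TTheory GRing.Theory Num.Theory.
Import numFieldNormedType.Exports.

Local Open Scope classical_set_scope.
Local Open Scope ring_scope.

(* Points of R^n are row vectors.  The library norm on 'rV[R]_n is the sup
   norm: it is used here only for the topology, and the Euclidean structure is
   given by dotp and enorm. *)

Section Calculus.
Context {R : realType} {n : nat}.
Local Notation V := 'rV[R]_n.

Definition dotp (v w : V) : R := \sum_(i < n) v 0 i * w 0 i.

Definition enorm (v : V) : R := Num.sqrt (dotp v v).

Definition basis_vec (i : 'I_n) : V := delta_mx 0 i.

Definition partial (i : 'I_n) (f : V -> R) : V -> R :=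
  fun x => 'D_(basis_vec i) f x.

Definition grad (f : V -> R) (x : V) : V := \row_i partial i f x.

Definition hessian (f : V -> R) (x : V) : 'M[R]_n :=
  \matrix_(i, j) partial i (partial j f) x.

Definition posdef (A : 'M[R]_n) : Prop :=
  forall v : V, v != 0 -> 0 < dotp (v *m A) v.

(* To be used with U open: the partial derivatives of order at most k exist
   and are continuous in U. *)
Fixpoint Ck (k : nat) (U : set V) (f : V -> R) : Prop :=
  (forall x, U x -> {for x, continuous f}) /\
  (if k is k'.+1 then
     forall i : 'I_n, (forall x, U x -> derivable f x (basis_vec i)) /\
                      Ck k' U (partial i f)
   else True).

Definition smooth (U : set V) (f : V -> R) : Prop := forall k, Ck k U f.

(* Smoothness on a subset S of R^n which need not be open, such as a
   hypersurface: f|_S is locally the restriction of a smooth function. *)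
Definition smooth_along (S : set V) (f : V -> R) : Prop :=
  forall p, S p -> exists (U : set V) (g : V -> R),
    [/\ open U, U p, smooth U g & forall x, S x -> U x -> f x = g x].

Definition strictly_convex_on (W : set V) (u : V -> R) : Prop :=
  forall x, W x -> posdef (hessian u x).

(* The extension of the gradient of u from the open set W to its closure. *)
Definition grad_closure (W : set V) (u : V -> R) (x : V) : V :=
  lim (grad u y @[y --> within W (nbhs x)]).

(* u is in C^1 of the closure of the open set W: u is continuous on the
   closure, and is differentiable in W with a gradient that extends
   continuously to the closure.  The filter within W (nbhs x) is not punctured,
   so at x in W the third clause is the continuity of grad u at x. *)
Definition C1_closure (W : set V) (u : V -> R) : Prop :=
  [/\ {within closure W, continuous u},
      forall x, W x -> differentiable u x,
      forall x, closure W x -> cvg (grad u y @[y --> within W (nbhs x)]) &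
      {within closure W, continuous (grad_closure W u)}].

(* The suprema are taken in \bar R, so that they are meaningful without a
   boundedness hypothesis. *)
Definition sup_norm (A : set V) (u : V -> R) : \bar R :=
  ereal_sup [set `|u x|%:E | x in A].

Definition C1_norm (W : set V) (u : V -> R) : \bar R :=
  (sup_norm (closure W) u +
   ereal_sup [set (enorm (grad_closure W u x))%:E | x in closure W])%E.

End Calculus.

Section Domains.
Context {R : realType} {n : nat}.
Local Notation V := 'rV[R]_n.

Definition frontier (A : set V) : set V := closure A `\` interior A.

(* For p in the frontier of D this forces rho p = 0, and near p the frontier
   is the regular level set [rho = 0]. *)
Definition defining_function (D : set V) (p : V) (rho : V -> R) : Prop :=
  exists U : set V,
    [/\ open U, U p, smooth U rho, forall x, U x -> (D x <-> rho x < 0) &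
        grad rho p != 0].

(* The unit normal, pointing into D, of the frontier of D at p. *)
Definition inner_unit_normal (D : set V) (p v : V) : Prop :=
  exists2 rho, defining_function D p rho &
    v = - ((enorm (grad rho p))^-1 *: grad rho p).

(* G is a smooth closed strictly convex hypersurface and D is the region it
   encloses.  The last clause says that the second fundamental form
   D^2 rho (t, t) / |grad rho| of G at p is positive definite on the tangent
   space of G at p. *)
Definition strictly_convex_hypersurface (G D : set V) : Prop :=
  [/\ open D, bounded_set D, convex_set D, G = frontier D &
      forall p, G p -> exists2 rho, defining_function D p rho &
        forall t : V, t != 0 -> dotp (grad rho p) t = 0 ->
          0 < dotp (t *m hessian rho p) t].

(* W is the region between the exterior boundary Gp and the interior
   boundary Gm, which both enclose the origin. *)
Definition annular_domain (W Gp Gm : set V) : Prop :=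
  exists Dp Dm : set V,
    [/\ strictly_convex_hypersurface Gp Dp,
        strictly_convex_hypersurface Gm Dm,
        Dm 0, closure Dm `<=` Dp & W = Dp `\` closure Dm].

End Domains.

(* Main.v *)
(* A solution is convex along every segment of Omega, and only lines and
   comparison are needed.  If the problem has no solution for any gamma0 there
   is nothing to prove; otherwise one solution w is fixed, and its bounds, which
   do not depend on the other solutions, serve for the barriers, so that nothing
   has to be known about psi near the boundary.

   Upper bound: the ray from y in Gm along nu ends on Gp, hence
   0 >= u y + T (gamma0 u y + phi y).  Lower bound: u - 2 w - A |x|^2 / 2 has no
   minimum in Omega, since det D^2 (2 w) > psi^n, and for A large its minimum
   over Gm can only be attained where u >= 0.

   Gradient: by convexity it is enough to bound the slope of u along a segment
   where it leaves Omega.  On Gp the barrier is 2 w plus a multiple of a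
   supporting linear function.  On Gm tangential slopes are bounded because the
   tangent lines end on Gp, and the normal slope is gamma0 u + phi, so gamma0 has
   to be bounded.  At a maximum point y of u on Gm strict convexity of Gm gives
   grad u y = a nu with a >= 0, whence u >= u y on the cap
   {nu . (x - y) > 0}, and u <= 0 there by lines parallel to its base.
   Since det D^2 u = psi^n, u oscillates by a fixed amount on the cap, so
   - u y >= k > 0, and 0 <= a = gamma0 u y + phi y bounds gamma0. *)
Require Import Defs.
From HB Require Import structures.
From mathcomp Require Import all_boot all_order all_algebra ring lra.
From mathcomp Require Import all_classical all_reals all_analysis.
Set Implicit Arguments.
Unset Strict Implicit.
Unset Printing Implicit Defensive.
Import Order.TTheory GRing.Theory Num.Theory.
Import numFieldNormedType.Exports.
Local Open Scope classical_set_scope.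
Local Open Scope ring_scope.

(** * Directional derivatives and the mean value theorem along lines *)

Section Line_derivatives.
Context {R : realType}.

(** Multiplying the difference quotient by [h] removes the punctured limit: [h = 0] is allowed, and
    the estimate can be restricted to lines, translated and added. *)
Lemma is_deriveP (V : normedModType R) (f : V -> R) (x v : V) (d : R) :
  is_derive x v f d <->
  forall e : R, 0 < e -> exists2 r : R, 0 < r &
    forall h : R, `|h| < r -> `|f (h *: v + x) - f x - h * d| <= e * `|h|.
Proof.
split=> [[dfv <-] e e0|H].
  have /cvgrPdist_lt/(_ e e0)/nbhs_normP[r /= r0 fr] := dfv.
  exists r => // h hr; have [->|h0] := eqVneq h 0.
    by rewrite scale0r add0r subrr sub0r mul0r oppr0 normr0 mulr0.
  have := fr h.
  rewrite /ball_ /= sub0r normrN => /(_ hr h0).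
  have hp : 0 < `|h| by rewrite normr_gt0.
  rewrite -/('D_v f x) distrC => /ltW.
  rewrite -(ler_pM2r hp) -normrM; apply: le_trans.
  by rewrite mulrBl (mulrC ('D_v f x)) [_^-1 *: _]mulrC divfK.
have cvgd : h^-1 *: ((f \o shift x) (h *: v) - f x) @[h --> 0^'] --> d.
  apply/cvgrPdist_le => e /H[r r0 fr]; apply/nbhs_normP; exists r => //= h.
  rewrite /ball_ /=.
  rewrite sub0r normrN => /fr {}fr h0.
  have hp : 0 < `|h| by rewrite normr_gt0.
  rewrite distrC -(ler_pM2r hp) -normrM; apply: le_trans fr.
  by rewrite mulrBl (mulrC d) [_^-1 *: _]mulrC divfK.
by apply: DeriveDef; [exact: cvgP cvgd|exact: cvg_lim cvgd].
Qed.

Lemma is_derive_line (V : normedModType R) (f : V -> R) (x v : V) (t d : R) :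
  is_derive (x + t *: v) v f d -> is_derive t 1 (fun s => f (x + s *: v)) d.
Proof.
move=> /is_deriveP H; apply/is_deriveP => e /H[r r0 fr]; exists r => // h hr.
by rewrite [_%:A]mulr1 scalerDl addrCA; exact: fr.
Qed.

(** The sign of [t] is left free, hence the absolute values; the two signs reduce to the mean value
    theorem on [[0, t]] and on [[t, 0]]. *)
Lemma MVT_line (V : normedModType R) (f df : V -> R) (x v : V) (t : R) :
  (forall s : R, `|s| <= `|t| -> is_derive (x + s *: v) v f (df (x + s *: v))) ->
  exists2 s : R, `|s| <= `|t| & f (x + t *: v) - f x = t * df (x + s *: v).
Proof.
move=> fdf.
pose g s := f (x + s *: v); pose dg s := df (x + s *: v).
have gdg (s : R) : `|s| <= `|t| -> is_derive s 1 g (dg s).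
  by move=> /fdf; exact: is_derive_line.
have cg (a b : R) : (forall s : R, a <= s <= b -> `|s| <= `|t|) ->
    {within `[a, b], continuous g}.
  move=> ab; apply: derivable_within_continuous => s; rewrite in_itv/= => /ab.
  by move=> /gdg[].
have [t0|t0] := leP 0 t.
  have st (s : R) : 0 <= s <= t -> `|s| <= `|t|.
    by move=> /andP[s0 st]; rewrite !ger0_norm.
  have h0t (s : R) : s \in `]0, t[ -> is_derive s 1 g (dg s).
    rewrite in_itv/= => /andP[/ltW ? /ltW ?]; apply: gdg; apply: st.
    exact/andP.
  have [s] := MVT_segment t0 h0t (cg _ _ st).
  by rewrite in_itv/= subr0 /g scale0r addr0 mulrC => /st ? ?; exists s.
have st (s : R) : t <= s <= 0 -> `|s| <= `|t|.
  by move=> /andP[? ?]; rewrite !ler0_norm ?lerN2// ltW.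
have h0t (s : R) : s \in `]t, 0[ -> is_derive s 1 g (dg s).
  rewrite in_itv/= => /andP[/ltW ? /ltW ?]; apply: gdg; apply: st.
  exact/andP.
have [s] := MVT_segment (ltW t0) h0t (cg _ _ st).
rewrite in_itv/= sub0r /g scale0r addr0 => /st ? H; exists s => //.
by rewrite -opprB H mulrN opprK mulrC.
Qed.

End Line_derivatives.

(** * Small radii, and derivatives along sums of directions *)

Lemma exists_lt_both {R : realType} (a b : R) : 0 < a -> 0 < b ->
  exists s, [/\ 0 < s, s < a & s < b].
Proof.
move=> a0 b0; have m0 : 0 < Num.min a b by rewrite lt_min a0.
exists (Num.min a b / 2).
have : Num.min a b / 2 < Num.min a b.
  by rewrite ltr_pdivrMr// mulr_natr mulr2n ltrDl.
by rewrite lt_min => /andP[? ?]; split=> //; rewrite divr_gt0.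
Qed.

Section Neighborhoods.
Context {R : realType} {V : normedModType R}.

Lemma open_norm_ball (U : set V) (x : V) : open U -> U x ->
  exists2 r : R, 0 < r & forall y, `|y - x| < r -> U y.
Proof.
move=> oU Ux; have /nbhs_normP[r /= r0 rU] := open_nbhs_nbhs (conj oU Ux).
by exists r => // y yx; apply: rU; rewrite /ball_ /= distrC.
Qed.

Lemma continuous_at_norm (W : normedModType R) (f : V -> W) (x : V) :
  {for x, continuous f} -> forall e : R, 0 < e ->
  exists2 r : R, 0 < r & forall y, `|y - x| < r -> `|f y - f x| < e.
Proof.
move=> /cvgrPdist_lt fx e /fx/nbhs_normP[r /= r0 rf].
by exists r => // y yx; rewrite distrC; apply: rf; rewrite /ball_ /= distrC.
Qed.

(** The increment is split into a move along [v] and then one along [w]. The mean value theorem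
    turns the second into [h c] times [D] at a point near [x], and [D] is continuous at [x]. *)
Lemma is_derive_addl (f D : V -> R) (x v w : V) (d c r : R) : 0 < r ->
  is_derive x v f d -> (forall y, `|y - x| < r -> is_derive y w f (D y)) ->
  {for x, continuous D} -> is_derive x (v + c *: w) f (d + c * D x).
Proof.
move=> r0 /is_deriveP fv fw /continuous_at_norm cD; apply/is_deriveP => e e0.
have e20 : 0 < e / 2 by rewrite divr_gt0.
have c10 : 0 < `|c| + 1 by rewrite ltr_wpDl.
have [r1 r10 fr1] := fv _ e20.
have [r2 r20 Dr2] := cD (e / 2 / (`|c| + 1)) (divr_gt0 e20 c10).
pose K := `|v| + `|c| * `|w| + 1.
have K0 : 0 < K by rewrite ltr_wpDl// addr_ge0// mulr_ge0.
pose m := Num.min r r2.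
have m0 : 0 < m by rewrite lt_min r0.
exists (Num.min r1 (m / K)); first by rewrite lt_min r10 divr_gt0.
move=> h; rewrite lt_min ltr_pdivlMr// => /andP[hr1 hm].
pose y := h *: v + x.
have near_x (s : R) : `|s| <= `|h * c| -> `|y + s *: w - x| < m.
  move=> sh; apply: le_lt_trans hm; rewrite /y addrAC addrK.
  rewrite (le_trans (ler_normD _ _))// !normrZ /K !mulrDr mulr1.
  rewrite -addrA lerD2l (@le_trans _ _ (`|h| * (`|c| * `|w|)))//.
    by rewrite mulrA -normrM ler_wpM2r.
  by rewrite lerDl.
have [s sh E] : exists2 s : R, `|s| <= `|h * c| &
    f (y + (h * c) *: w) - f y = h * c * D (y + s *: w).
  apply: MVT_line => s sh; apply: fw.
  by have := near_x _ sh; rewrite lt_min => /andP[].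
have -> : h *: (v + c *: w) + x = y + (h * c) *: w.
  by rewrite scalerDr scalerA addrAC.
have -> : f (y + (h * c) *: w) - f x - h * (d + c * D x) =
  (f y - f x - h * d) + h * c * (D (y + s *: w) - D x).
  by rewrite mulrBr -E; ring.
rewrite (le_trans (ler_normD _ _))// (splitr e) mulrDl lerD//; first exact: fr1.
rewrite normrM [in leRHS]mulrC normrM -mulrA ler_wpM2l//.
have Ds : `|D (y + s *: w) - D x| <= e / 2 / (`|c| + 1).
  by apply/ltW/Dr2; have := near_x _ sh; rewrite lt_min => /andP[].
rewrite (le_trans (ler_wpM2l (normr_ge0 _) Ds))// mulrCA ger_pMr//.
by rewrite ler_pdivrMr// mul1r lerDl.
Qed.

End Neighborhoods.

(** * Euclidean product against the sup norm *)

Section Dot_product.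
Context {R : realType} {n : nat}.
Local Notation V := 'rV[R]_n.
Implicit Types u v w : V.

Lemma dotpE v w : dotp v w = (v *m w^T) 0 0.
Proof. by rewrite mxE; apply: eq_bigr => i _; rewrite mxE. Qed.

Lemma dotpC v w : dotp v w = dotp w v.
Proof. by apply: eq_bigr => i _; rewrite mulrC. Qed.

Lemma dotpDl u v w : dotp (u + v) w = dotp u w + dotp v w.
Proof. by rewrite !dotpE mulmxDl mxE. Qed.

Lemma dotpDr u v w : dotp u (v + w) = dotp u v + dotp u w.
Proof. by rewrite dotpC dotpDl !(dotpC u). Qed.

Lemma dotpZl a v w : dotp (a *: v) w = a * dotp v w.
Proof. by rewrite !dotpE -scalemxAl mxE. Qed.

Lemma dotpZr a v w : dotp v (a *: w) = a * dotp v w.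
Proof. by rewrite dotpC dotpZl dotpC. Qed.

Lemma dotpNl v w : dotp (- v) w = - dotp v w.
Proof. by rewrite -scaleN1r dotpZl mulN1r. Qed.

Lemma dotpNr v w : dotp v (- w) = - dotp v w.
Proof. by rewrite dotpC dotpNl dotpC. Qed.

Lemma dotpBl u v w : dotp (u - v) w = dotp u w - dotp v w.
Proof. by rewrite dotpDl dotpNl. Qed.

Lemma dotpBr u v w : dotp u (v - w) = dotp u v - dotp u w.
Proof. by rewrite dotpDr dotpNr. Qed.

Lemma dotp0 v : dotp v 0 = 0.
Proof. by rewrite -(scale0r (0 : 'rV[R]_n)) dotpZr mul0r. Qed.

Lemma dotp_ge0 v : 0 <= dotp v v.
Proof. by apply: sumr_ge0 => i _; rewrite -expr2 sqr_ge0. Qed.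

Lemma dotp_eq0 v : (dotp v v == 0) = (v == 0).
Proof.
apply/idP/eqP => [/eqP/psumr_eq0P v0|->]; last by rewrite dotp0.
apply/rowP => i; rewrite mxE; apply/eqP; rewrite -sqrf_eq0 expr2.
by apply/eqP/v0 => // j _; rewrite -expr2 sqr_ge0.
Qed.

Lemma dotp_gt0 v : (0 < dotp v v) = (v != 0).
Proof. by rewrite lt_def dotp_ge0 andbT dotp_eq0. Qed.

Lemma ler_norm_coord v i : `|v 0 i| <= `|v|.
Proof.
rewrite [leRHS]/Num.Def.normr /= mx_normrE.
by apply/bigmax_geP; right; exists (0, i).
Qed.

Lemma ler_norm_row v a : 0 <= a -> (forall i, `|v 0 i| <= a) -> `|v| <= a.
Proof.
move=> a0 va; rewrite [leLHS]/Num.Def.normr /= mx_normrE; apply/bigmax_leP.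
by split=> // -[i j] _ /=; rewrite ord1.
Qed.

(** A substitute for the Cauchy-Schwarz inequality; the factor [n] is the price of the sup norm. *)
Lemma ler_norm_dotp v w : `|dotp v w| <= n%:R * (`|v| * `|w|).
Proof.
apply: le_trans (ler_norm_sum _ _ _) _.
have -> : n%:R * (`|v| * `|w|) = \sum_(i < n) `|v| * `|w|.
  by rewrite sumr_const card_ord mulr_natl.
by apply: ler_sum => i _; rewrite normrM ler_pM// ler_norm_coord.
Qed.

Lemma sqr_norm_le_dotp v : `|v| ^+ 2 <= dotp v v.
Proof.
rewrite -[leRHS]sqr_sqrtr ?dotp_ge0// lerXn2r ?nnegrE ?sqrtr_ge0//.
apply: ler_norm_row => [|i]; first exact: sqrtr_ge0.
rewrite -sqrtr_sqr ler_sqrt ?dotp_ge0// /dotp (bigD1 i)//= -expr2 lerDl.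
by apply: sumr_ge0 => j _; rewrite -expr2 sqr_ge0.
Qed.

Lemma norm_dotp1 v : dotp v v = 1 -> `|v| <= 1.
Proof.
by move=> v1; rewrite -(@expr_le1 _ 2)// -v1 sqr_norm_le_dotp.
Qed.

Lemma continuous_dotp v : continuous (dotp v).
Proof.
move=> x; apply/(@cvgrPdist_lt _ _ _ (nbhs x)) => e e0.
apply/(@nbhs_normP _ V).
have K0 : 0 < n%:R * `|v| + 1 by rewrite ltr_wpDl// mulr_ge0.
exists (e / (n%:R * `|v| + 1)) => /=; first exact: divr_gt0.
move=> y; rewrite /ball_ /= ltr_pdivlMr// => xy; apply: le_lt_trans xy.
rewrite -dotpBr (le_trans (ler_norm_dotp _ _))// mulrA mulrC ler_wpM2l//.
by rewrite lerDl.
Qed.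

End Dot_product.

(** * Directional derivatives through the gradient and the Hessian *)

Section Smooth_functions.
Context {R : realType} {n : nat}.
Local Notation V := 'rV[R]_n.
Implicit Types (U : set V) (f : V -> R).

Lemma Ck_pred k U f : Ck k.+1 U f -> Ck k U f.
Proof.
elim: k f => [|k IH] f [cf Hf]; first by split.
by split=> // i; have [di Ci] := Hf i; split=> //; exact: IH.
Qed.

(** The coordinates of [v] are added one at a time by [is_derive_addl], which applies because each
    partial derivative exists near [x] and is continuous. *)
Lemma Ck1_is_derive U f x v : open U -> Ck 1 U f -> U x ->
  is_derive x v f (dotp (grad f x) v).
Proof.
move=> oU [cf Cf] Ux; have [r r0 rU] := open_norm_ball oU Ux.
rewrite [v in is_derive _ v]row_sum_delta.
have -> : dotp (grad f x) v = \sum_(i < n) v 0 i * partial i f x.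
  by apply: eq_bigr => i _; rewrite mxE mulrC.
elim: (index_enum _) => [|i s IH]; first by rewrite !big_nil; exact: is_derive0.
rewrite !big_cons addrC [in X in is_derive _ _ _ X]addrC.
have [di [ci _]] := Cf i.
apply: (is_derive_addl _ r0) => //.
  by move=> y /rU /di; exact: derivableP.
exact: ci.
Qed.

Lemma Ck2_is_derive U f x v : open U -> Ck 2 U f -> U x ->
  is_derive x v (fun y => dotp (grad f y) v) (dotp (v *m hessian f x) v).
Proof.
move=> oU [cf Cf] Ux.
have -> : (fun y => dotp (grad f y) v) = \sum_(i < n) (v 0 i *: partial i f).
  apply/funext => y; rewrite /dotp fct_sumE; apply: eq_bigr => i _.
  by rewrite mxE mulrC.
have -> : dotp (v *m hessian f x) v =
    \sum_(i < n) v 0 i * dotp (grad (partial i f) x) v.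
  apply: eq_bigr => i _; rewrite mulrC; congr (_ * _); rewrite mxE.
  by apply: eq_bigr => j _; rewrite !mxE mulrC.
apply: is_derive_sum => i; apply: is_deriveZ.
by apply: Ck1_is_derive Ux => //; have [] := Cf i.
Qed.

End Smooth_functions.

(** * Symmetry of the Hessian, and a second derivative test on the line *)

Section Hessian_symmetry.
Context {R : realType} {n : nat}.
Local Notation V := 'rV[R]_n.

Lemma is_derive_translate (f : V -> R) (x a v : V) d :
  is_derive (x + a) v f d -> is_derive x v (fun y => f (y + a)) d.
Proof.
move=> /is_deriveP H; apply/is_deriveP => e /H[r r0 fr]; exists r => // h hr.
by have := fr h hr; rewrite addrA.
Qed.

Lemma norm_basis_vec (i : 'I_n) : `|basis_vec i : V| <= 1.
Proof.
apply: ler_norm_row => // j; rewrite mxE.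
by case: (_ && _); rewrite ?normr1 ?normr0.
Qed.

(** Two uses of the mean value theorem: along [i] for the difference [phi] in direction [j], then
    along [j] for [partial i f]. *)
Lemma mixed_difference (U : set V) (f : V -> R) (x : V) (i j : 'I_n) (r h : R) :
  Ck 2 U f -> (forall y, `|y - x| < r -> U y) -> `|h| + `|h| < r ->
  exists2 p, `|p - x| <= `|h| + `|h| &
    f (x + h *: basis_vec i + h *: basis_vec j) - f (x + h *: basis_vec i)
      - (f (x + h *: basis_vec j) - f x) =
    h * (h * partial j (partial i f) p).
Proof.
move=> [cf Cf] rU hr; have [dif [_ ddif]] := Cf i.
have nearU s t : `|s| <= `|h| -> `|t| <= `|h| ->
    `|x + s *: basis_vec i + t *: basis_vec j - x| <= `|h| + `|h|.
  move=> sh th; rewrite addrAC (addrC x) addrK.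
  rewrite (le_trans (ler_normD _ _))// !normrZ lerD//.
    by rewrite (le_trans _ sh)// ler_piMr// norm_basis_vec.
  by rewrite (le_trans _ th)// ler_piMr// norm_basis_vec.
have inU s t : `|s| <= `|h| -> `|t| <= `|h| ->
    U (x + s *: basis_vec i + t *: basis_vec j).
  by move=> sh th; apply/rU/(le_lt_trans _ hr)/nearU.
have h0 : `|0 : R| <= `|h| by rewrite normr0.
pose phi y := f (y + h *: basis_vec j) - f y.
pose dphi y := partial i f (y + h *: basis_vec j) - partial i f y.
have dphiP (s : R) : `|s| <= `|h| ->
    is_derive (x + s *: basis_vec i) (basis_vec i) phi
      (dphi (x + s *: basis_vec i)).
  move=> sh; apply: is_deriveB.
    apply: is_derive_translate; apply/derivableP/dif; exact: inU.
  apply/derivableP/dif; have := inU s 0 sh h0.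
  by rewrite scale0r addr0.
have [s sh Es] := MVT_line dphiP.
have ddphiP (t : R) : `|t| <= `|h| ->
    is_derive (x + s *: basis_vec i + t *: basis_vec j) (basis_vec j)
      (partial i f)
      (partial j (partial i f) (x + s *: basis_vec i + t *: basis_vec j)).
  move=> th; apply/derivableP.
  by have [+ _] := ddif j; apply; exact: inU.
have [t th Et] := MVT_line ddphiP.
exists (x + s *: basis_vec i + t *: basis_vec j); first exact: nearU.
by rewrite -Et -Es.
Qed.

(** The mixed second difference is symmetric in [i] and [j], so the two mixed partials take a common
    value at points [p] and [q] near [x]; both are continuous at [x]. *)
Lemma hessian_sym (U : set V) (f : V -> R) (x : V) :
  open U -> Ck 2 U f -> U x -> (hessian f x)^T = hessian f x.
Proof.
move=> oU Cf Ux; apply/matrixP => i j; rewrite !mxE.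
have cont k l : {for x, continuous (partial k (partial l f))}.
  by have [_ /(_ l)[_ [_ /(_ k)[_ [+ _]]]]] := Cf; apply.
have [r r0 rU] := open_norm_ball oU Ux.
apply/eqP; rewrite -subr_eq0 -normr_le0; apply/ler_addgt0Pr => e e0; rewrite add0r.
have [r1 r10 f1] := continuous_at_norm (cont j i) (divr_gt0 e0 (ltr0n _ 2)).
have [r2 r20 f2] := continuous_at_norm (cont i j) (divr_gt0 e0 (ltr0n _ 2)).
pose m := Num.min r (Num.min r1 r2).
have m0 : 0 < m by rewrite !lt_min r0 r10.
pose h := m / 4.
have h0 : 0 < h by rewrite divr_gt0.
have hm : `|h| + `|h| < m by rewrite gtr0_norm// /h; lra.
have /andP[hr /andP[hr1 hr2]] : [&& `|h| + `|h| < r, `|h| + `|h| < r1 & `|h| + `|h| < r2].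
  by move: hm; rewrite !lt_min.
have [p px Ep] := mixed_difference i j Cf rU hr.
have [q qx Eq] := mixed_difference j i Cf rU hr.
have E (A B C D a b : R) : A - B - (C - D) = h * (h * a) ->
    A - C - (B - D) = h * (h * b) -> a = b.
  move=> Ea Eb; apply: (mulfI (lt0r_neq0 h0)); apply: (mulfI (lt0r_neq0 h0)).
  by rewrite -Ea -Eb; ring.
rewrite (addrAC x) in Ep; have {}E := E _ _ _ _ _ _ Ep Eq.
have {}f1 := f1 _ (le_lt_trans px hr1); have {}f2 := f2 _ (le_lt_trans qx hr2).
rewrite E in f1; rewrite (splitr e) -normrN opprB.
apply: le_trans (ler_distD (partial i (partial j f) q) _ _) _.
rewrite distrC in f2; exact: lerD (ltW f2) (ltW f1).
Qed.

Lemma is_derive_reflect (g : R -> R) (s d : R) :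
  is_derive (- s) (1 : R) g d -> is_derive s (1 : R) (fun s => g (- s)) (- d).
Proof.
move=> /is_deriveP H; apply/is_deriveP => e /H[r r0 fr]; exists r => // h hr.
have := fr (- h); rewrite normrN => /(_ hr).
by rewrite scaleNr -opprD mulrN mulNr.
Qed.

Lemma second_difference_ge (g dg : R -> R) (d2 m r : R) : 0 < r ->
  (forall t : R, `|t| < r -> is_derive t (1 : R) g (dg t)) ->
  is_derive (0 : R) (1 : R) dg d2 ->
  (forall t : R, `|t| < r -> - m * t ^+ 2 <= g t + g (- t) - 2 * g 0) ->
  - m <= d2.
Proof.
move=> r0 gdg /is_deriveP dgd2 gm; rewrite leNgt; apply/negP => d2m.
pose e := (- m - d2) / 4.
have e0 : 0 < e by rewrite divr_gt0// subr_gt0.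
have [r1 r10 dgr] := dgd2 _ e0.
have [t [t0 tr tr1]] := exists_lt_both r0 r10.
pose k := d2 + e.
(* k < - m and the even part of g, minus k s^2, decreases. *)
pose G s := g (- s) + g s + (- k) * (s * s).
pose dG s := - dg (- s) + dg s + (- k) * (s + s).
have GdG (s : R) : `|s| < r -> is_derive s (1 : R) G (dG s).
  move=> sr; apply: is_deriveD; last first.
    apply: (@is_deriveZ _ _ _ (fun s : R => s * s) (- k)).
    apply: is_derive_eq (is_deriveM (is_derive_id s (1 : R)) (is_derive_id s (1 : R))) _.
    by rewrite ![_%:A]mulr1.
  apply: is_deriveD; last exact: gdg.
  by apply: is_derive_reflect; apply: gdg; rewrite normrN.
have dG0t (s : R) : s \in `]0, t[ -> is_derive s (1 : R) G (dG s).
  rewrite in_itv/= => /andP[s0 st].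
  by apply: GdG; rewrite gtr0_norm// (lt_trans st).
have cG : {within `[0, t], continuous G}.
  apply: derivable_within_continuous => s; rewrite in_itv/= => /andP[s0 st].
  have sr : `|s| < r by rewrite ger0_norm// (le_lt_trans st).
  by have [] := GdG _ sr.
have [s] := MVT t0 dG0t cG; rewrite in_itv/= => /andP[s0 st].
rewrite /G oppr0 => E.
have := gm t; rewrite gtr0_norm// => /(_ tr).
have sr1 : `|s| < r1 by rewrite gtr0_norm// (lt_trans st).
have := dgr _ sr1; have := dgr (- s); rewrite normrN => /(_ sr1).
rewrite ![_%:A]mulr1 !addr0 (gtr0_norm s0) !ler_norml => /andP[A1 A2] /andP[B1 B2].
(* Both [dg s] and [dg (- s)] are within [e * s] of their linear parts, so [dg s - dg (- s)] is at
   most [2 s (d2 + e) = 2 k s]. *)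
have dG0 : dG s <= 0 by rewrite /dG /k; nra.
have {E} : g (- t) + g t - k * (t * t) - (g 0 + g 0) <= 0.
  rewrite (_ : _ - _ = dG s * t); first by rewrite mulr_le0_ge0// ltW.
  by move: E; rewrite addr0 => <-; ring.
have -> : k = - m - 3 * e by rewrite /k /e; field.
have et : 0 < e * (t * t) by apply: mulr_gt0 => //; exact: mulr_gt0.
by move: et; lra.
Qed.

End Hessian_symmetry.

(** * Monotonicity of the determinant on positive definite matrices *)

Section Determinant_monotonicity.
Context {R : realType}.

(** The Schur complement of the upper left entry, written for symmetric [A]: the transpose of the
    first row stands for the first column. *)
Definition schur m (A : 'M[R]_(1 + m)) : 'M[R]_m :=
  drsubmx A - (A 0 0)^-1 *: ((ursubmx A)^T *m ursubmx A).

Lemma sym_block m (A : 'M[R]_(1 + m)) : A^T = A ->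
  A = block_mx (A 0 0)%:M (ursubmx A) (ursubmx A)^T (drsubmx A).
Proof.
move=> At; rewrite -[LHS]submxK; congr block_mx.
  by rewrite [LHS]mx11_scalar !mxE; congr (A _ _)%:M; apply: val_inj.
by rewrite trmx_ursub At.
Qed.

Lemma schur_sym m (A : 'M[R]_(1 + m)) : A^T = A -> (schur A)^T = schur A.
Proof.
move=> At; rewrite /schur linearB/= linearZ/= trmx_mul trmxK.
by rewrite trmx_drsub At.
Qed.

Lemma det_schur m (A : 'M[R]_(1 + m)) : A^T = A -> A 0 0 != 0 ->
  \det A = A 0 0 * \det (schur A).
Proof.
move=> At a0; set a := A 0 0; set r := ursubmx A.
have E : block_mx 1%:M 0 (- a^-1 *: r^T) 1%:M *m A =
    block_mx a%:M r 0 (schur A).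
  rewrite [A in LHS]sym_block// mulmx_block !mul1mx !mul0mx !addr0.
  congr block_mx.
    by rewrite mul_mx_scalar scalerA mulrN divff// scaleN1r addNr.
  by rewrite -scalemxAl scaleNr addrC.
have := congr1 determinant E.
by rewrite det_mulmx det_lblock !det1 !mul1r det_ublock det_scalar1.
Qed.

(** Completion of the square in the first coordinate [s]. *)
Lemma quad_form_schur m (A : 'M[R]_(1 + m)) (s : R) (w : 'rV[R]_m) :
  A^T = A -> A 0 0 != 0 ->
  dotp (row_mx s%:M w *m A) (row_mx s%:M w) =
  dotp (w *m schur A) w
    + A 0 0 * (s + (A 0 0)^-1 * dotp (ursubmx A) w) ^+ 2.
Proof.
move=> At a0; set a := A 0 0; set r := ursubmx A.
have Er : (r *m w^T) = (dotp r w)%:M by rewrite [LHS]mx11_scalar dotpE.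
have Ec : w *m r^T = (dotp r w)%:M.
  by rewrite -[LHS]trmxK trmx_mul trmxK Er tr_scalar_mx.
rewrite !dotpE [A in LHS]sym_block// -/a -/r mul_row_block tr_row_mx mul_row_col.
rewrite tr_scalar_mx /schur mulmxBr mulmxBl !mulmxDl -/a -/r.
rewrite -(mulmxA s%:M r) Er -[w *m drsubmx A *m _]/(_ *m _).
rewrite -scalemxAr -scalemxAl Ec.
rewrite [w *m (_ *m _)]mulmxA Ec -[_ *m r *m _]mulmxA Er -!scalar_mxM.
rewrite !mxE eqxx !mulr1n.
by field.
Qed.

Lemma det_le m (A B : 'M[R]_m) : A^T = A -> B^T = B -> posdef B ->
  (forall v, dotp (v *m B) v <= dotp (v *m A) v) ->
  0 < \det B <= \det A.
Proof.
elim: m A B => [|m IH] A B At Bt Bpos BA.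
  by rewrite !det_mx00 ltr01 lexx.
change ('M[R]_(1 + m)) in A, B.
have e0 (M : 'M[R]_(1 + m)) : dotp (row_mx 1%:M 0 *m M) (row_mx 1%:M 0) = M 0 0.
  rewrite dotpE tr_row_mx -[M in LHS]submxK mul_row_block mul_row_col.
  rewrite !trmx0 !mulmx0 !mul0mx !addr0 mul1mx trmx1 mulmx1 !mxE.
  by congr (M _ _); apply: val_inj.
have v0 : row_mx 1%:M 0 != 0 :> 'rV[R]_(1 + m).
  apply/eqP => /rowP/(_ 0); rewrite !mxE; case: split_ordP => // j; rewrite ord1.
  by move=> _; rewrite !mxE eqxx => /eqP; rewrite oner_eq0.
have b0 : 0 < B 0 0 by rewrite -e0; exact: Bpos.
have ab : B 0 0 <= A 0 0 by rewrite -!e0.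
have a0 : 0 < A 0 0 := lt_le_trans b0 ab.
(* The first coordinate at which the completed square vanishes. *)
pose s (M : 'M[R]_(1 + m)) (w : 'rV[R]_m) := - ((M 0 0)^-1 * dotp (ursubmx M) w).
have qs M w : M^T = M -> 0 < M 0 0 ->
    dotp (row_mx (s M w)%:M w *m M) (row_mx (s M w)%:M w) = dotp (w *m schur M) w.
  move=> Mt M0; rewrite quad_form_schur ?lt0r_neq0//.
  by rewrite /s addNr expr0n mulr0 addr0.
have Spos : posdef (schur B).
  move=> w w0; rewrite -qs//; apply: Bpos; apply: contra w0 => /eqP w0.
  by have := row_mxKr (s B w)%:M w; rewrite w0 linear0 => <-.
have SBA w : dotp (w *m schur B) w <= dotp (w *m schur A) w.
  rewrite -(qs A)// (le_trans _ (BA _))// quad_form_schur ?lt0r_neq0//.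
  by rewrite lerDl mulr_ge0 ?sqr_ge0// ltW.
have /andP[dB dBA] := IH _ _ (schur_sym At) (schur_sym Bt) Spos SBA.
rewrite !det_schur ?lt0r_neq0//; apply/andP; split; first exact: mulr_gt0.
by apply: ler_pM => //; exact: ltW.
Qed.

(** [2 ^ m * \det B <= \det A], and [2 ^ m > 1] for [m > 0]. *)
Lemma det_lt_double m (A B : 'M[R]_m) : (0 < m)%N -> A^T = A -> B^T = B ->
  posdef B -> (forall v, 2 * dotp (v *m B) v <= dotp (v *m A) v) ->
  \det B < \det A.
Proof.
move=> m0 At Bt Bpos BA.
have B2t : (2%:R *: B)^T = 2%:R *: B by rewrite linearZ/= Bt.
have B2pos : posdef (2%:R *: B).
  move=> v v0; rewrite -scalemxAr dotpZl; apply: mulr_gt0; first exact: ltr0n.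
  exact: Bpos.
have B2A v : dotp (v *m (2%:R *: B)) v <= dotp (v *m A) v.
  by rewrite -scalemxAr dotpZl; exact: BA.
have /andP[dB _] := det_le Bt Bt Bpos (fun=> lexx _).
have /andP[_] := det_le At B2t B2pos B2A; apply: lt_le_trans.
by rewrite detZ ltr_pMl// exprn_egt1// ?ltr1n// -lt0n.
Qed.

End Determinant_monotonicity.

(** * Hessians at interior extrema *)

Section Comparison_at_extrema.
Context {R : realType} {n : nat}.
Local Notation V := 'rV[R]_n.
Implicit Types (U : set V) (u w : V -> R).

Lemma small_step (v : V) (r : R) : 0 < r ->
  exists2 s : R, 0 < s & forall t, `|t| < s -> `|t *: v| < r.
Proof.
move=> r0; have v1 : 0 < `|v| + 1 by rewrite ltr_wpDl.
exists (r / (`|v| + 1)) => [|t]; first exact: divr_gt0.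
rewrite normrZ ltr_pdivlMr// => tr; apply: le_lt_trans tr.
by rewrite ler_wpM2l// lerDl.
Qed.

(** One statement for two uses: [a = 1], [b = -2], [m = 0] at a minimum of [u - 2 w - q], and
    [a = -1], [b = 0] at a maximum of [u] minus a paraboloid. *)
Lemma hessian_test U u w (a b m r : R) (z v : V) : open U -> Ck 2 U u ->
  Ck 2 U w -> U z -> 0 < r ->
  (forall t : R, `|t| < r ->
     - m * t ^+ 2 <= a * (u (z + t *: v) + u (z - t *: v) - 2 * u z)
                     + b * (w (z + t *: v) + w (z - t *: v) - 2 * w z)) ->
  - m <= a * dotp (v *m hessian u z) v + b * dotp (v *m hessian w z) v.
Proof.
move=> oU Cu Cw Uz r0 H; have [r1 r10 rU] := open_norm_ball oU Uz.
have [s s0 sv] := small_step v r10.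
pose g t := a * u (z + t *: v) + b * w (z + t *: v).
pose dg t := a * dotp (grad u (z + t *: v)) v + b * dotp (grad w (z + t *: v)) v.
have inU (t : R) : `|t| < s -> U (z + t *: v).
  by move=> ts; apply: rU; rewrite addrC addKr; exact: sv.
have is_derive_lin (f : V -> R) (df : R) (c t : R) :
    is_derive (z + t *: v) v f df ->
    is_derive t 1 (fun t => c * f (z + t *: v)) (c * df).
  by move=> fdf; apply: is_deriveZ; exact: is_derive_line.
apply: (@second_difference_ge R g dg _ m (Num.min r s)).
- by rewrite lt_min r0.
- move=> t; rewrite lt_min => /andP[_ /inU Ut].
  by apply: is_deriveD; apply: is_derive_lin; apply: Ck1_is_derive Ut => //;
    exact: Ck_pred.
- have Uz0 : U (z + 0 *: v) by rewrite scale0r addr0.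
  have -> : hessian u z = hessian u (z + 0 *: v) by rewrite scale0r addr0.
  have -> : hessian w z = hessian w (z + 0 *: v) by rewrite scale0r addr0.
  apply: is_deriveD.
    by apply: (is_derive_lin (fun y => dotp (grad u y) v)); exact: Ck2_is_derive Uz0.
  by apply: (is_derive_lin (fun y => dotp (grad w y) v)); exact: Ck2_is_derive Uz0.
- move=> t; rewrite lt_min => /andP[/H tr _]; apply: le_trans tr _.
  by rewrite /g scaleNr scale0r addr0 le_eqVlt; apply/orP; left; apply/eqP; ring.
Qed.

(* 2 w is a strict subsolution: det D^2 (2 w) = 2^n det D^2 w. *)
Lemma no_interior_min U u w (q : V -> R) (r : R) (z : V) : (0 < n)%N ->
  open U -> Ck 2 U u -> Ck 2 U w -> strictly_convex_on U u ->
  strictly_convex_on U w -> U z -> \det (hessian u z) = \det (hessian w z) ->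
  (forall x v, 2 * q x <= q (x + v) + q (x - v)) -> 0 < r ->
  (forall y, `|y - z| < r -> u z - 2 * w z - q z <= u y - 2 * w y - q y) ->
  False.
Proof.
have lin (a b : R) : - 0 <= 1 * b + (- 2) * a -> 2 * a <= b by lra.
have combine (uz wz qz up um wp wm qp qm t : R) :
    uz - 2 * wz - qz <= up - 2 * wp - qp ->
    uz - 2 * wz - qz <= um - 2 * wm - qm -> 2 * qz <= qp + qm ->
    - 0 * t <= 1 * (up + um - 2 * uz) + - 2 * (wp + wm - 2 * wz) by lra.
move=> n0 oU Cu Cw su sw Uz duw cq r0 zmin.
(* At the minimum the second differences of [u - 2 w] are at least those of [q], which are
   nonnegative. *)
have H v : 2 * dotp (v *m hessian w z) v <= dotp (v *m hessian u z) v.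
  have [s s0 sv] := small_step v r0.
  apply: lin.
  apply: (hessian_test oU Cu Cw Uz s0) => t /sv tv.
  have h1 : `|z + t *: v - z| < r by rewrite addrC addKr.
  have h2 : `|z - t *: v - z| < r by rewrite addrC addKr normrN.
  exact: combine (zmin _ h1) (zmin _ h2) (cq z (t *: v)).
have dlt := det_lt_double n0 (hessian_sym oU Cu Uz) (hessian_sym oU Cw Uz) (sw _ Uz) H.
by move: (gt_eqF dlt) => /eqP; apply.
Qed.

(** At a local maximum of [u - d |y - x|^2 / 2] the Hessian of [u] is at most [d] times the
    identity, and [det_le] applies. *)
Lemma det_hessian_le U u (d r : R) (x z : V) : (0 < n)%N -> open U -> Ck 2 U u ->
  strictly_convex_on U u -> U z -> 0 < r ->
  (forall y, `|y - z| < r ->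
    u y - d / 2 * dotp (y - x) (y - x) <= u z - d / 2 * dotp (z - x) (z - x)) ->
  \det (hessian u z) <= d ^+ n.
Proof.
have lin (a b : R) : - b <= (- 1) * a + 0 * a -> a <= b by lra.
have combine (uz up um a b c t : R) :
    up - d / 2 * (a + 2 * t * b + t ^+ 2 * c) <= uz - d / 2 * a ->
    um - d / 2 * (a + 2 * - t * b + (- t) ^+ 2 * c) <= uz - d / 2 * a ->
    - (d * c) * t ^+ 2 <= - 1 * (up + um - 2 * uz) + 0 * (up + um - 2 * uz).
  by lra.
have E (c : R) (y v : V) : dotp (y + c *: v) (y + c *: v) =
    dotp y y + 2 * c * dotp y v + c ^+ 2 * dotp v v.
  by rewrite !(dotpDl, dotpDr, dotpZl, dotpZr) (dotpC v y); ring.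
move=> n0 oU Cu su Uz r0 zmax.
have H v : dotp (v *m hessian u z) v <= dotp (v *m d%:M) v.
  have [s s0 sv] := small_step v r0.
  rewrite mul_mx_scalar dotpZl; apply: lin.
  apply: (hessian_test oU Cu Cu Uz s0) => t /sv tv.
  have h1 : `|z + t *: v - z| < r by rewrite addrC addKr.
  have h2 : `|z - t *: v - z| < r by rewrite addrC addKr normrN.
  have := zmax _ h2; have := zmax _ h1.
  rewrite (addrAC z (t *: v)) (addrAC z (- (t *: v))) -(scaleNr t v) !E.
  exact: combine.
have := det_le (tr_scalar_mx _ _) (hessian_sym oU Cu Uz) (su _ Uz) H.
by rewrite det_scalar => /andP[].
Qed.

End Comparison_at_extrema.

(** * Boundary gradients and the supporting inequality *)

Section Functions_of_class_C1_closure.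
Context {R : realType} {n : nat}.
Local Notation V := 'rV[R]_n.
Implicit Types (W : set V) (u : V -> R) (x y v : V).

Lemma grad_closure_near W u x (e : R) : C1_closure W u -> closure W x -> 0 < e ->
  exists2 r : R, 0 < r &
    forall y, W y -> `|y - x| < r -> `|grad u y - grad_closure W u x| < e.
Proof.
move=> [_ _ cg _] Wx e0; have pF := within_nbhs_proper Wx.
have /(@cvgrPdist_lt _ _ _ _ pF) /(_ e e0) := cg _ Wx.
rewrite near_withinE => /nbhs_normP[r /= r0 rg]; exists r => // y Wy yx.
by rewrite distrC; apply: rg => //; rewrite /ball_ /= distrC.
Qed.

Lemma grad_closure_in W u x : C1_closure W u -> W x ->
  grad_closure W u x = grad u x.
Proof.
move=> Cu Wx; apply/eqP; rewrite eq_sym -subr_eq0 -normr_le0.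
apply/ler_addgt0Pr => e e0; rewrite add0r.
have [r r0 H] := grad_closure_near Cu (subset_closure Wx) e0.
by apply/ltW/H => //; rewrite subrr normr0.
Qed.

Lemma within_continuous_near (A : set V) (W : normedModType R) (f : V -> W) x (e : R) :
  {within A, continuous f} -> A x -> 0 < e ->
  exists2 r : R, 0 < r & forall y, A y -> `|y - x| < r -> `|f y - f x| < e.
Proof.
move=> /subspace_continuousP cf Ax e0.
have /cvgrPdist_lt/(_ e e0) := cf _ Ax.
rewrite near_withinE => /nbhs_normP[r /= r0 rg]; exists r => // y Ay yx.
by rewrite distrC; apply: rg => //; rewrite /ball_ /= distrC.
Qed.

Lemma closure_norm (A : set V) x :
  (forall e : R, 0 < e -> exists2 y, A y & `|y - x| < e) <-> closure A x.
Proof.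
split=> [H B /nbhs_normP[r /= r0 rB]|Ax e e0].
  have [y Ay yx] := H r r0; exists y; split=> //.
  by apply: rB; rewrite /ball_ /= distrC.
have [|y [Ay yx]] := Ax (fun y : V => `|y - x| < e).
  by apply/(@nbhs_normP _ V); exists e => // y; rewrite /ball_ /= distrC.
by exists y.
Qed.

Lemma dotp_le_near (a b v : V) (e : R) :
  `|a - b| < e / (n%:R * `|v| + 1) -> dotp a v <= dotp b v + e.
Proof.
have K0 : 0 < n%:R * `|v| + 1 by rewrite ltr_wpDl// mulr_ge0.
rewrite ltr_pdivlMr// => ab; rewrite -lerBlDl -dotpBl.
rewrite (le_trans (ler_norm _))// (le_trans (ler_norm_dotp _ _))//.
apply: le_trans (ltW ab); rewrite mulrCA ler_wpM2l//.
by rewrite lerDl.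
Qed.

Lemma closure_segment_end W x v (T : R) : 0 < T ->
  (forall s : R, 0 < s < T -> W (x + s *: v)) ->
  forall s : R, 0 <= s <= T -> closure W (x + s *: v).
Proof.
move=> T0 WT s /andP[s0 sT]; apply/closure_norm => e e0.
have [r r0 rv] := small_step v e0.
have [m [m0 mr mT]] := exists_lt_both r0 T0.
have [sm|sm] := leP s (T / 2).
  exists (x + (s + m / 2) *: v).
    apply: WT; apply/andP; split; first by rewrite ltr_wpDl// divr_gt0.
    by lra.
  rewrite opprD addrACA subrr add0r -scalerBl addrAC subrr add0r.
  by apply: rv; rewrite gtr0_norm; lra.
exists (x + (s - m / 2) *: v).
  apply: WT; apply/andP; split; lra.
rewrite opprD addrACA subrr add0r -scalerBl addrAC subrr add0r.
by apply: rv; rewrite normrN gtr0_norm; lra.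
Qed.

(** [W] is not convex, so the tangent inequality is stated along a segment with its open part in
    [W]; both ends may lie on the boundary. The positive Hessian makes the slope increase along the
    segment, and the mean value theorem gives the slope at some [xi]. *)
Lemma supporting_ineq W u x v (T : R) : open W -> Ck 2 W u -> C1_closure W u ->
  strictly_convex_on W u -> closure W x -> 0 < T ->
  (forall s : R, 0 < s < T -> W (x + s *: v)) ->
  u x + T * dotp (grad_closure W u x) v <= u (x + T *: v).
Proof.
move=> oW C2 C1 su Wx T0 WT.
pose f s := u (x + s *: v); pose df s := dotp (grad u (x + s *: v)) v.
have inT (s : R) : s \in `]0, T[ -> W (x + s *: v).
  by rewrite in_itv => /WT.
have fdf (s : R) : s \in `]0, T[ -> is_derive s (1 : R) f (df s).
  by move=> /inT Ws; apply: is_derive_line; apply: Ck1_is_derive Ws => //; exact: Ck_pred.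
have cf : {within `[0, T], continuous f}.
  apply/subspace_continuousP => s; rewrite /= in_itv/= => sT.
  apply/cvgrPdist_lt => e e0.
  have [cu _ _ _] := C1.
  have [r r0 ru] := within_continuous_near cu (closure_segment_end T0 WT sT) e0.
  have [r' r'0 rv] := small_step v r0.
  rewrite near_withinE; apply/nbhs_normP; exists r' => // t /=.
  rewrite /ball_ /= => st; rewrite in_itv/= => tT.
  rewrite distrC; apply: ru; first exact: closure_segment_end tT.
  by rewrite opprD addrACA subrr add0r -scalerBl; apply: rv; rewrite distrC.
have [xi xiT E] := MVT T0 fdf cf.
have df_mono (s : R) : 0 < s -> s < xi -> df s <= df xi.
  move=> s0 sxi.
  have sub t : s <= t <= xi -> W (x + t *: v).
    move: xiT; rewrite in_itv/= => /andP[_ xiT] /andP[st txi]; apply: WT.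
    by rewrite (lt_le_trans s0 st) (le_lt_trans txi xiT).
  pose ddf t := dotp (v *m hessian u (x + t *: v)) v.
  have dddf t : s <= t <= xi -> is_derive t (1 : R) df (ddf t).
    move=> /sub Wt; apply: (is_derive_line (f := fun y => dotp (grad u y) v)).
    exact: Ck2_is_derive Wt.
  have dddf' (t : R) : t \in `]s, xi[ -> is_derive t (1 : R) df (ddf t).
    by rewrite in_itv/= => /andP[/ltW ? /ltW ?]; apply: dddf; apply/andP.
  have cdf : {within `[s, xi], continuous df}.
    apply: derivable_within_continuous => y; rewrite in_itv/= => /dddf dy.
    by case: dy.
  have [t txi dE] := MVT sxi dddf' cdf.
  rewrite -subr_ge0 dE; apply: mulr_ge0; last by rewrite subr_ge0 ltW.
  rewrite /ddf; have [->|v0] := eqVneq v 0; first by rewrite dotp0.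
  apply/ltW/su; last by [].
  apply: sub; move: txi; rewrite in_itv/=.
  by move=> /andP[/ltW ? /ltW ?]; apply/andP.
(* The slope at [x] is only a limit of interior slopes, so it is compared with [df s] for small
   [s < xi], up to [e]. *)
suff H : dotp (grad_closure W u x) v <= df xi.
  move: E; rewrite /f subr0 scale0r addr0 => E.
  by rewrite addrC -lerBrDr E mulrC ler_wpM2r// ltW.
apply/ler_addgt0Pr => e e0.
have K0 : 0 < n%:R * `|v| + 1 by rewrite ltr_wpDl// mulr_ge0.
have [r r0 rg] := grad_closure_near C1 Wx (divr_gt0 e0 K0).
have [r' r'0 rv] := small_step v r0.
have xi0 : 0 < xi by move: xiT; rewrite in_itv/= => /andP[].
have [s [s0 sr sxi]] := exists_lt_both r'0 xi0.
apply: (@le_trans _ _ (df s + e)); last by rewrite lerD2r; exact: df_mono.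
apply: dotp_le_near; rewrite distrC; apply: rg.
  apply: WT; rewrite s0 (lt_trans sxi)//.
  by move: xiT; rewrite in_itv/= => /andP[].
by rewrite addrC addKr; apply: rv; rewrite gtr0_norm.
Qed.

End Functions_of_class_C1_closure.

(** * Exit points of lines, and segments in convex sets *)

Section Bounded_sets.
Context {R : realType} {n : nat}.
Local Notation V := 'rV[R]_n.
Implicit Types (A D W U : set V) (x y z v : V).

Lemma bounded_norm A : bounded_set A ->
  exists2 M : R, 0 < M & forall x, A x -> `|x| <= M.
Proof. by move=> /pinfty_ex_gt0[M M0 AM]; exists M. Qed.

Lemma closure_norm_le A (M : R) x : (forall y, A y -> `|y| <= M) ->
  closure A x -> `|x| <= M.
Proof.
move=> AM /closure_norm Ax; apply/ler_addgt0Pr => e /Ax[y Ay yx].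
rewrite -(subKr y x) (le_trans (ler_normB _ _))//.
exact: lerD (AM _ Ay) (ltW yx).
Qed.

(** [T] is the supremum of the lengths that stay in [W]; were the end point in [W], openness would
    allow a longer segment. *)
Lemma exit_point W x v (e : R) : open W -> bounded_set W -> v != 0 -> 0 < e ->
  (forall s : R, 0 < s < e -> W (x + s *: v)) ->
  exists T : R, [/\ e <= T, forall s : R, 0 < s < T -> W (x + s *: v) &
                 ~ W (x + T *: v)].
Proof.
move=> oW /bounded_norm[M M0 WM] v0 e0 We.
have nv0 : 0 < `|v| by rewrite normr_gt0.
pose S := [set t : R | 0 < t /\ forall s : R, 0 < s < t -> W (x + s *: v)].
have Se : S e by [].
(* The factor 2 comes from using the midpoint [t / 2], since the point at [t] itself need not lie in
   [W]. *)
have ubS : ubound S ((M + `|x|) / `|v| * 2).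
  move=> t [t0 Wt]; rewrite -ler_pdivrMr// ler_pdivlMr//.
  have -> : t / 2 * `|v| = `|(t / 2) *: v| by rewrite normrZ gtr0_norm// divr_gt0.
  rewrite -(addKr x (_ *: v)) addrC (le_trans (ler_normB _ _))// lerD2r.
  by apply/WM/Wt; apply/andP; split; lra.
have hS : has_sup S by split; [exists e|exists ((M + `|x|) / `|v| * 2)].
have eT : e <= sup S by apply: sup_ubound => //; case: hS.
have WT (s : R) : 0 < s < sup S -> W (x + s *: v).
  move=> /andP[s0 sT]; have sS : 0 < sup S - s by rewrite subr_gt0.
  have [t [t0 Wt]] := sup_adherent sS hS.
  by rewrite subKr => st; apply: Wt; rewrite s0.
exists (sup S); split=> // WxT.
have [r r0 rW] := open_norm_ball oW WxT.
have [r' r'0 rv] := small_step v r0.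
suff : S (sup S + r' / 2).
  by move=> /(sup_ubound (proj2 hS)); rewrite gerDl leNgt divr_gt0.
split; first by rewrite addr_gt0 ?divr_gt0// (lt_le_trans e0).
move=> s /andP[s0 sr]; have [sT|Ts] := ltP s (sup S).
  by apply: WT; rewrite s0.
apply: rW; rewrite opprD addrACA subrr add0r -scalerBl; apply: rv.
by rewrite ger0_norm ?subr_ge0// ltrBlDl (lt_trans sr)// ltrD2l; lra.
Qed.

Lemma convex_setP D x y (s : R) : convex_set D -> D x -> D y -> 0 <= s <= 1 ->
  D (s *: x + (1 - s) *: y).
Proof.
move=> cD Dx Dy /andP[s0 s1].
by have := cD x y (Itv01 s0 s1); rewrite !inE; apply.
Qed.

Lemma convex_segment D x y (s : R) : open D -> convex_set D -> closure D x -> D y ->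
  0 < s <= 1 -> D (x + s *: (y - x)).
Proof.
move=> oD cD Dx Dy /andP[s0]; rewrite le_eqVlt => /predU1P[->|s1].
  by rewrite scale1r addrC subrK.
have [r r0 rD] := open_norm_ball oD Dy.
have t0 : 0 < 1 - s by rewrite subr_gt0.
(* [x] is replaced by a point [x'] of [D], and [y] is moved to compensate by [(1 - s) / s] times
   [x - x']; the tolerance [r * s] keeps [y'] in the ball about [y]. *)
have e0 : 0 < r * s by rewrite mulr_gt0.
have [x' Dx' xx'] := (closure_norm _ _).2 Dx _ e0.
pose y' := y + ((1 - s) / s) *: (x - x').
have Dy' : D y'.
  apply: rD; rewrite addrC addKr normrZ ger0_norm ?divr_ge0 ?ltW//.
  rewrite distrC mulrAC ltr_pdivrMr//; apply: le_lt_trans xx'.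
  by rewrite ler_piMl// lerBlDr lerDl ltW.
have -> : x + s *: (y - x) = s *: y' + (1 - s) *: x'.
  by apply/rowP => i; rewrite /y' !mxE; field; rewrite gt_eqF.
by apply: convex_setP => //; rewrite !ltW.
Qed.

Lemma frontier_open D x : open D -> frontier D x <-> closure D x /\ ~ D x.
Proof. by move=> oD; rewrite /frontier ((interior_id D).1 oD). Qed.

End Bounded_sets.

(** * Local geometry of a hypersurface from its defining function *)

Section Defining_functions.
Context {R : realType} {n : nat}.
Local Notation V := 'rV[R]_n.
Implicit Types (D U : set V) (x y z v : V) (rho : V -> R).

Lemma defining_function_eq0 D y rho : defining_function D y rho ->
  closure D y -> ~ D y -> rho y = 0.
Proof.
move=> [U [oU Uy srho Drho _]] cDy nDy; apply/eqP; rewrite eq_le; apply/andP; split.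
  apply/ler_addgt0Pr => e e0; rewrite add0r.
  have [r r0 rU] := open_norm_ball oU Uy.
  have [crho _] := srho 0%N; have [r' r'0 rrho] := continuous_at_norm (crho _ Uy) e0.
  have m0 : 0 < Num.min r r' by rewrite lt_min r0.
  have [z Dz] := (closure_norm _ _).2 cDy _ m0.
  rewrite lt_min => /andP[/rU Uz /rrho]; rewrite ltr_norml => /andP[+ _].
  by have := (Drho _ Uz).1 Dz; lra.
by rewrite leNgt; apply/negP => /(Drho _ Uy).2.
Qed.

Lemma near0_line U y v : open U -> U y ->
  exists2 r : R, 0 < r & forall s : R, `|s| < r -> U (y + s *: v).
Proof.
move=> oU Uy; have [r r0 rU] := open_norm_ball oU Uy.
have [s s0 sv] := small_step v r0; exists s => // t /sv tv.
by apply: rU; rewrite addrC addKr.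
Qed.

Lemma defining_function_line D y v rho : defining_function D y rho ->
  rho y = 0 -> exists2 r : R, 0 < r & forall s : R, 0 < s < r ->
    [/\ (dotp (grad rho y) v < 0 -> D (y + s *: v)) &
        (0 < dotp (grad rho y) v -> ~ D (y + s *: v))].
Proof.
move=> [U [oU Uy srho Drho _]] rho0.
have [r r0 rU] := near0_line v oU Uy.
have /is_deriveP H := Ck1_is_derive v oU (srho 1%N) Uy.
have [d0|d0] := eqVneq (dotp (grad rho y) v) 0.
  by exists 1 => // s _; rewrite d0 ltxx.
have [|r' r'0 Hr] := H (`|dotp (grad rho y) v| / 2).
  by rewrite divr_gt0// normr_gt0.
exists (Num.min r r'); first by rewrite lt_min r0.
move=> s /andP[s0]; rewrite lt_min => /andP[sr sr'].
have Us : U (y + s *: v) by apply: rU; rewrite gtr0_norm.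
have := Hr s; rewrite gtr0_norm// => /(_ sr').
rewrite rho0 subr0 (addrC (s *: v)) ler_norml => /andP[H1 H2].
split=> dv.
  apply/(Drho _ Us); move: H2; rewrite ltr0_norm//.
  have : dotp (grad rho y) v * s < 0 by rewrite nmulr_rlt0.
  by move: (dotp _ _) (rho _) => a b; lra.
move=> /(Drho _ Us); move: H1; rewrite gtr0_norm//.
have : 0 < dotp (grad rho y) v * s by rewrite mulr_gt0.
by move: (dotp _ _) (rho _) => a b; lra.
Qed.

(** A segment from [y] into convex [D] cannot start in a direction that increases [rho]. Strictness
    follows by pushing [z] a little along the gradient inside open [D]. *)
Lemma defining_function_support D y z rho : open D -> convex_set D ->
  defining_function D y rho -> closure D y -> ~ D y -> D z ->
  dotp (grad rho y) (z - y) < 0.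
Proof.
move=> oD cD drho cDy nDy Dz; have rho0 := defining_function_eq0 drho cDy nDy.
have weak x : D x -> dotp (grad rho y) (x - y) <= 0.
  move=> Dx; rewrite leNgt; apply/negP => d0.
  have [r r0 rD] := defining_function_line (x - y) drho rho0.
  have [s [s0 sr s1]] := exists_lt_both r0 ltr01.
  have [|_ /(_ d0) nD] := rD s; first by rewrite s0.
  by apply: nD; apply: convex_segment => //; rewrite s0 ltW.
have [r r0 rD] := near0_line (grad rho y) oD Dz.
have [U [_ _ _ _ g0]] := drho.
have rr : `|r / 2| < r by rewrite gtr0_norm ?divr_gt0//; lra.
have := weak _ (rD _ rr); rewrite addrAC (dotpDr _ (z - y)) dotpZr.
apply: lt_le_trans.
by rewrite ltrDl mulr_gt0 ?dotp_gt0// divr_gt0.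
Qed.

Lemma dotp_le_closure D (a b : V) c : (forall z, D z -> dotp a (z - b) <= c) ->
  forall z, closure D z -> dotp a (z - b) <= c.
Proof.
move=> H z Dz; apply/ler_addgt0Pr => e e0.
have K0 : 0 < n%:R * `|a| + 1 by rewrite ltr_wpDl// mulr_ge0.
have [y Dy yz] := (closure_norm _ _).2 Dz _ (divr_gt0 e0 K0).
apply: (@le_trans _ _ (dotp a (y - b) + e)); last by rewrite lerD2r; exact: H.
rewrite !(dotpC a); apply: dotp_le_near.
by rewrite opprB addrA subrK distrC.
Qed.

(** Along [v] the derivative of [rho] vanishes at [y] with positive derivative, so [rho] becomes
    positive at once, and it stays positive near each such point. *)
Lemma defining_function_tangent D y v rho : defining_function D y rho ->
  rho y = 0 -> dotp (grad rho y) v = 0 -> 0 < dotp (v *m hessian rho y) v ->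
  exists2 r : R, 0 < r & forall s : R, 0 < s < r -> ~ closure D (y + s *: v).
Proof.
move=> [U [oU Uy srho Drho _]] rho0 d0 d20.
have [r r0 rU] := near0_line v oU Uy.
have /is_deriveP H := Ck2_is_derive v oU (srho 2%N) Uy.
set d2 := dotp (v *m hessian rho y) v in d20 H.
have [|r' r'0 Hr] := H (d2 / 2); first by rewrite divr_gt0.
exists (Num.min r r'); first by rewrite lt_min r0.
move=> s /andP[s0]; rewrite lt_min => /andP[sr sr'].
pose f t := rho (y + t *: v); pose df t := dotp (grad rho (y + t *: v)) v.
have fdf (t : R) : `|t| < r -> is_derive t (1 : R) f (df t).
  by move=> /rU Ut; apply: is_derive_line; apply: Ck1_is_derive Ut; [|exact: srho].
have fdf0 (t : R) : t \in `]0, s[ -> is_derive t (1 : R) f (df t).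
  rewrite in_itv/= => /andP[t0 ts]; apply: fdf.
  by rewrite gtr0_norm// (lt_trans ts).
have cf : {within `[0, s], continuous f}.
  apply: derivable_within_continuous => t; rewrite in_itv/= => /andP[t0 ts].
  have tr : `|t| < r by rewrite ger0_norm// (le_lt_trans ts).
  by case: (fdf _ tr).
have [t + E] := MVT s0 fdf0 cf; rewrite in_itv/= => /andP[t0 ts].
have dft : 0 < df t.
  have := Hr t; rewrite gtr0_norm// (lt_trans ts)// => /(_ erefl).
  rewrite d0 subr0 (addrC (t *: v)) ler_norml => /andP[+ _].
  have : 0 < t * d2 by rewrite mulr_gt0.
  by rewrite /df; move: (dotp _ v) => a; lra.
have rhos : 0 < rho (y + s *: v).
  move: E; rewrite /f subr0 scale0r addr0 rho0 subr0 => ->.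
  by rewrite mulr_gt0.
have Us : U (y + s *: v) by apply: rU; rewrite gtr0_norm.
have [r1 r10 rU1] := open_norm_ball oU Us.
have [crho _] := srho 0%N.
have [r2 r20 rrho] := continuous_at_norm (crho _ Us) rhos.
move=> cD; have m0 : 0 < Num.min r1 r2 by rewrite lt_min r10.
have [z Dz] := (closure_norm _ _).2 cD _ m0.
rewrite lt_min => /andP[/rU1 Uz /rrho]; rewrite ltr_norml => /andP[+ _].
by have := (Drho _ Uz).1 Dz; lra.
Qed.

End Defining_functions.

(** * The geometric facts about the annular domain *)

Section Annular_geometry.
Context {R : realType} {n : nat}.
Local Notation V := 'rV[R]_n.
Implicit Types (W Dp Dm Gp Gm : set V) (x y z v : V) (nu : V -> V).

(* The strict convexity of the outer boundary enters only through its supporting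
   hyperplanes; the curvature of the inner one only through [inner_tangent]. *)
Record annulus W Dp Dm nu : Prop := Annulus {
  annulusE : W = Dp `\` closure Dm;
  open_outer : open Dp;
  open_inner : open Dm;
  bounded_outer : bounded_set Dp;
  convex_inner : convex_set Dm;
  inner0 : Dm 0;
  inner_outer : closure Dm `<=` Dp;
  outer_support : forall y, frontier Dp y -> exists2 N : V, dotp N N = 1 &
    forall z, closure Dp z -> dotp N (z - y) <= 0;
  normal1 : forall y, frontier Dm y -> dotp (nu y) (nu y) = 1;
  inner_support : forall y, frontier Dm y -> forall z, closure Dm z ->
    dotp (nu y) (z - y) <= 0;
  inner_transversal : forall y v, frontier Dm y -> dotp (nu y) v < 0 ->
    exists2 r : R, 0 < r & forall s : R, 0 < s < r -> Dm (y + s *: v);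
  inner_tangent : forall y v, frontier Dm y -> v != 0 -> dotp (nu y) v = 0 ->
    exists2 r : R, 0 < r & forall s : R, 0 < s < r -> ~ closure Dm (y + s *: v) }.

Lemma unit_scale (g : V) : g != 0 ->
  dotp ((enorm g)^-1 *: g) ((enorm g)^-1 *: g) = 1.
Proof.
move=> g0; have e0 : enorm g != 0.
  by rewrite /enorm gt_eqF// sqrtr_gt0 dotp_gt0.
rewrite dotpZl dotpZr mulrA -invfM -expr2 sqr_sqrtr ?dotp_ge0// mulVf//.
by rewrite dotp_eq0.
Qed.

Lemma enorm_gt0 (g : V) : g != 0 -> 0 < enorm g.
Proof. by move=> g0; rewrite /enorm sqrtr_gt0 dotp_gt0. Qed.

(** Let [t] be the part of [a] orthogonal to [b]. Testing with [t - d b] for small [d > 0] gives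
    [dotp t t <= 0]. *)
Lemma half_space_normal (a b : V) : b != 0 ->
  (forall v, dotp b v < 0 -> dotp a v <= 0) -> exists2 k : R, 0 <= k & a = k *: b.
Proof.
move=> b0 H; have bb : 0 < dotp b b by rewrite dotp_gt0.
pose k := dotp a b / dotp b b; pose t := a - k *: b.
have bt : dotp b t = 0.
  by rewrite dotpBr dotpZr /k divfK ?gt_eqF// dotpC subrr.
exists k.
  apply: divr_ge0; last exact: ltW.
  have := H (- b); rewrite !dotpNr !oppr_lt0 oppr_le0; exact.
suff /eqP : dotp t t == 0 by move=> /eqP; rewrite dotp_eq0 subr_eq0 => /eqP.
rewrite eq_le dotp_ge0 andbT.
have -> : dotp t t = dotp a t by rewrite {1}/t dotpBl dotpZl bt mulr0 subr0.
apply/ler_addgt0Pr => e e0; rewrite add0r.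
have [d d0 dab] : exists2 d : R, 0 < d & d * dotp a b <= e.
  have K0 : 0 < `|dotp a b| + 1 by rewrite ltr_wpDl.
  exists (e / (`|dotp a b| + 1)); first exact: divr_gt0.
  rewrite mulrAC ler_pdivrMr// ler_pM2l//.
  by rewrite (le_trans (ler_norm _))// lerDl.
have := H (t - d *: b).
rewrite (dotpBr b t) (dotpBr a t) !dotpZr bt sub0r oppr_lt0 mulr_gt0//.
by move=> /(_ erefl); rewrite subr_le0 => /le_trans; exact.
Qed.

Lemma hypersurface_support (G D : set V) y :
  strictly_convex_hypersurface G D -> G y -> exists rho,
  [/\ [/\ defining_function D y rho, rho y = 0 & grad rho y != 0],
    forall z, D z -> dotp (grad rho y) (z - y) < 0,
    forall z, closure D z -> dotp (grad rho y) (z - y) <= 0 &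
    forall t : V, t != 0 -> dotp (grad rho y) t = 0 ->
      0 < dotp (t *m hessian rho y) t].
Proof.
move=> [oD bD cD GE H] Gy; have [rho drho Hrho] := H _ Gy.
have [cDy nDy] : closure D y /\ ~ D y by apply/frontier_open => //; rewrite -GE.
have rho0 := defining_function_eq0 drho cDy nDy.
exists rho; split=> //.
- by split=> //; have [U []] := drho.
- by move=> z; exact: defining_function_support.
- by apply: dotp_le_closure => z Dz; apply: ltW;
    exact: (defining_function_support oD cD drho cDy nDy Dz).
Qed.

(** [nu] is given through defining functions of [W], whereas convexity is expressed by those of
    [Dm]. The main point is that [nu] is a positive multiple of the gradient of the latter. *)
Lemma annular_domain_annulus W Gp Gm nu : annular_domain W Gp Gm ->
  (forall x, Gm x -> inner_unit_normal W x (nu x)) ->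
  exists Dp Dm, [/\ annulus W Dp Dm nu, Gp = frontier Dp & Gm = frontier Dm].
Proof.
move=> [Dp [Dm [Hp Hm Dm0 DmDp WE]]] Hnu.
have [oDp bDp _ GpE _] := Hp; have [oDm _ cDm GmE _] := Hm.
exists Dp, Dm; split=> //.
have normal y : frontier Dm y -> exists rho,
    [/\ defining_function Dm y rho, rho y = 0,
      forall z, closure Dm z -> dotp (grad rho y) (z - y) <= 0,
      forall t : V, t != 0 -> dotp (grad rho y) t = 0 ->
          0 < dotp (t *m hessian rho y) t &
      dotp (nu y) (nu y) = 1 /\ exists2 k, 0 < k & nu y = k *: grad rho y].
  rewrite -GmE => Gy.
  have [rho [[drho rho0 g0] gD gcD Hrho]] := hypersurface_support Hm Gy.
  have [rhoW drhoW nuE] := Hnu _ Gy.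
  have gW0 : grad rhoW y != 0 by have [U []] := drhoW.
  have cDmy : closure Dm y by move: Gy; rewrite GmE => -[].
  have nWy : ~ W y by rewrite WE => -[].
  have gy : 0 < dotp (grad rho y) y.
    by have := gD _ Dm0; rewrite sub0r dotpNr oppr_lt0.
  (* [y + s y] leaves [closure Dm], since the gradient at [y] has positive product with [y], and is
     still in [Dp] for small [s]. *)
  have cWy : closure W y.
    apply/closure_norm => e e0.
    have [r r0 rDp] := near0_line y oDp (DmDp _ cDmy).
    have [r' r'0 ry] := small_step y e0.
    have [s [s0 sr sr']] := exists_lt_both r0 r'0.
    exists (y + s *: y); last by rewrite addrC addKr; apply: ry; rewrite gtr0_norm.
    rewrite WE; split; first by apply: rDp; rewrite gtr0_norm.
    move=> /gcD; rewrite addrC addKr dotpZr leNgt => /negP; apply.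
    by rewrite mulr_gt0.
  have rhoW0 := defining_function_eq0 drhoW cWy nWy.
  have nu1 : dotp (nu y) (nu y) = 1 by rewrite nuE dotpNl dotpNr opprK unit_scale.
  exists rho; split=> //; split=> //.
  (* A direction that enters [Dm] cannot enter [W] as well, because the two sets are disjoint. *)
  have [v gv|k k0 nuk] := @half_space_normal (nu y) (grad rho y) g0.
    rewrite nuE dotpNl dotpZl oppr_le0 mulr_ge0//.
      by rewrite invr_ge0 ltW// enorm_gt0.
    rewrite leNgt; apply/negP => gWv.
    have [r r0 Hr] := defining_function_line v drho rho0.
    have [r' r'0 Hr'] := defining_function_line v drhoW rhoW0.
    have [s [s0 sr sr']] := exists_lt_both r0 r'0.
    have [|/(_ gv) Dms _] := Hr s; first by rewrite s0.
    have [|/(_ gWv) + _] := Hr' s; first by rewrite s0.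
    by rewrite WE => -[_]; apply; exact: subset_closure.
  exists k => //; rewrite lt_def k0 andbT; apply/eqP => k00.
  by move: nu1; rewrite nuk k00 scale0r dotp0 => /eqP; rewrite eq_sym oner_eq0.
split=> //.
- move=> y; rewrite -GpE => /(hypersurface_support Hp).
  move=> [rho [[drho rho0 g0] gD gcD Hrho]].
  exists ((enorm (grad rho y))^-1 *: grad rho y); first exact: unit_scale.
  move=> z /gcD zy; rewrite dotpZl mulr_ge0_le0//.
  by rewrite invr_ge0 ltW// enorm_gt0.
- by move=> y /normal[rho [_ _ _ _ []]].
- move=> y /normal[rho [_ _ H _ [_ [k k0 ->]]]] z /H zy.
  by rewrite dotpZl mulr_ge0_le0// ltW.
- move=> y v /normal[rho [drho rho0 _ _ [_ [k k0 ->]]]].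
  rewrite dotpZl pmulr_rlt0// => gv.
  have [r r0 Hr] := defining_function_line v drho rho0.
  by exists r => // s /Hr[+ _]; exact.
- move=> y v /normal[rho [drho rho0 _ H [_ [k k0 ->]]]] v0 /eqP.
  rewrite dotpZl mulf_eq0 gt_eqF//= => /eqP gv.
  exact: defining_function_tangent drho rho0 gv (H _ v0 gv).
Qed.

End Annular_geometry.

(** * Compactness and rays in the annulus *)

Section Annulus_theory.
Context {R : realType} {n : nat}.
Local Notation V := 'rV[R]_n.
Context {W Dp Dm : set V} {nu : V -> V}.
Context (annW : annulus W Dp Dm nu).
Implicit Types (x y z v : V).

Lemma annulus_open : open W.
Proof.
rewrite (annulusE annW) setDE; apply: openI; first exact: open_outer annW.
exact/closed_openC/closed_closure.
Qed.

Lemma annulus_outer x : W x -> Dp x.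
Proof. by rewrite (annulusE annW) => -[]. Qed.

Lemma annulus_notin x : W x -> ~ closure Dm x.
Proof. by rewrite (annulusE annW) => -[]. Qed.

Lemma annulus_bounded : bounded_set W.
Proof.
have [M M0 DM] := bounded_norm (bounded_outer annW).
exists M; split; first exact: num_real.
by move=> K MK x /annulus_outer/DM/le_trans; apply; exact: ltW.
Qed.

Lemma annulus_norm : exists2 M : R, 0 < M & forall x, closure W x -> `|x| <= M.
Proof.
have [M M0 WM] := bounded_norm annulus_bounded; exists M => // x.
exact: closure_norm_le.
Qed.

Lemma annulus_compact : compact (closure W).
Proof.
apply: bounded_closed_compact; last exact: closed_closure.
have [M M0 WM] := annulus_norm.
exists M; split; first exact: num_real.
by move=> K MK x /WM/le_trans; apply; exact: ltW.
Qed.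

Lemma annulus_boundary x : closure W x -> ~ W x -> frontier Dp x \/ frontier Dm x.
Proof.
move=> cWx nWx; have [Dpx|nDpx] := pselect (Dp x).
  right; apply/frontier_open; first exact: open_inner annW.
  split.
    by apply: contrapT => nDm; apply: nWx; rewrite (annulusE annW).
  move=> Dmx; have [r r0 rD] := open_norm_ball (open_inner annW) Dmx.
  have [z Wz zx] := (closure_norm _ _).2 cWx _ r0.
  by apply: (annulus_notin Wz); apply: subset_closure; exact: rD.
left; apply/frontier_open; first exact: open_outer annW.
by split=> //; apply: closure_subset cWx; exact: annulus_outer.
Qed.

(** By compactness of [closure Dm], a uniform width [d] for the annulus. *)
Lemma inner_gap : exists2 d : R, 0 < d &
  forall z w, closure Dm z -> `|w| < d -> Dp (z + w).
Proof.
have cDm : compact (closure Dm).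
  apply: bounded_closed_compact; last exact: closed_closure.
  have [M M0 DM] := bounded_norm (bounded_outer annW).
  exists M; split; first exact: num_real.
  move=> K MK x /(inner_outer annW)/DM/le_trans; apply; exact: ltW.
have := (compact_near_coveringP (closure Dm)).1 cDm V (nbhs (0 : V))
  (fun w z => Dp (z + w)) _.
have H z : closure Dm z -> \forall z' \near z & w \near (0 : V), Dp (z' + w).
  move=> /(inner_outer annW) Dpz.
  have [r r0 rD] := open_norm_ball (open_outer annW) Dpz.
  exists ([set z' : V | `|z' - z| < r / 2], [set w : V | `|w| < r / 2]).
    split; apply/(@nbhs_normP _ V); exists (r / 2) => /=; rewrite ?divr_gt0//.
      by move=> y; rewrite /ball_ /= distrC.
    by move=> y; rewrite /ball_ /= sub0r normrN.
  move=> [z' w] /= [zz ww]; apply: rD; rewrite addrAC (splitr r).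
  by rewrite (le_lt_trans (ler_normD _ _))// ltrD.
move=> /(_ _ H)/(@nbhs_normP _ V)[d /= d0 dD]; exists d => // z w cz wd.
by apply: dD => //; rewrite /ball_ /= sub0r normrN.
Qed.

(** The supporting inequality is tested at [(r / 2) nu y], a point of a ball about the origin inside
    [Dm]. *)
Lemma normal_origin : exists2 c : R, 0 < c &
  forall y, frontier Dm y -> c <= dotp (nu y) y.
Proof.
have [r r0 rD] := open_norm_ball (open_inner annW) (inner0 annW).
exists (r / 2); first by rewrite divr_gt0.
move=> y Gy; have nu1 := normal1 annW Gy.
have Dz : Dm ((r / 2) *: nu y).
  apply: rD; rewrite subr0 normrZ gtr0_norm ?divr_gt0//.
  rewrite (@le_lt_trans _ _ (r / 2))//; last by lra.
  apply: ler_piMr; first by rewrite divr_ge0// ltW.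
  exact: norm_dotp1.
have := inner_support annW Gy (subset_closure Dz).
by rewrite dotpBr dotpZr nu1 mulr1 subr_le0.
Qed.

Lemma ray_notin y v (s : R) : frontier Dm y -> 0 < dotp (nu y) v -> 0 < s ->
  ~ closure Dm (y + s *: v).
Proof.
move=> Gy v0 s0 /(inner_support annW Gy); rewrite addrC addKr dotpZr leNgt.
by move=> /negP; apply; rewrite mulr_gt0.
Qed.

(** The supporting hyperplane at [y] keeps the ray away from [closure Dm], so it can leave [W] only
    through the outer boundary, at distance at least [d]. *)
Lemma outward_ray (d : R) y v : 0 < d ->
  (forall z w, closure Dm z -> `|w| < d -> Dp (z + w)) ->
  frontier Dm y -> 0 < dotp (nu y) v ->
  exists T : R, [/\ 0 < T, d <= T * `|v|,
    forall s : R, 0 < s < T -> W (y + s *: v) & frontier Dp (y + T *: v)].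
Proof.
move=> d0 dD Gy v0; have [r r0 rv] := small_step v d0.
have vn0 : v != 0 by apply: contraTneq v0 => ->; rewrite dotp0 ltxx.
have cy : closure Dm y by case: Gy.
have Wr (s : R) : 0 < s < r -> W (y + s *: v).
  move=> /andP[s0 sr]; rewrite (annulusE annW); split; last exact: ray_notin.
  by apply: dD => //; apply: rv; rewrite gtr0_norm.
have [T [rT WT nWT]] := exit_point annulus_open annulus_bounded vn0 r0 Wr.
have T0 : 0 < T := lt_le_trans r0 rT.
have cT : closure W (y + T *: v).
  by apply: closure_segment_end WT _ _; rewrite // ltW//= lexx.
have GT : frontier Dp (y + T *: v).
  by have [//|[/(ray_notin Gy v0 T0)]] := annulus_boundary cT nWT.
exists T; split=> //; rewrite leNgt; apply/negP => Td.
move: GT => /(frontier_open _ (open_outer annW))[_]; apply; apply: dD => //.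
by rewrite normrZ gtr0_norm.
Qed.

Lemma inner_boundary_closure y : frontier Dm y -> closure W y.
Proof.
move=> Gy; have [d d0 dD] := inner_gap.
have nu0 : 0 < dotp (nu y) (nu y) by rewrite (normal1 annW Gy).
have [T [T0 _ WT _]] := outward_ray d0 dD Gy nu0.
rewrite -[y]addr0 -(scale0r (nu y)).
by apply: closure_segment_end WT _ _; rewrite // lexx ltW.
Qed.

Lemma interior_ray x v : W x -> v != 0 ->
  exists T : R, [/\ 0 < T, forall s : R, 0 <= s < T -> W (x + s *: v),
    closure W (x + T *: v) &
    frontier Dp (x + T *: v) \/ frontier Dm (x + T *: v)].
Proof.
move=> Wx v0; have [r r0 rW] := near0_line v annulus_open Wx.
have [|T [rT WT nWT]] := exit_point (x := x) annulus_open annulus_bounded v0 r0.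
  by move=> s /andP[s0 sr]; apply: rW; rewrite gtr0_norm.
have T0 := lt_le_trans r0 rT.
have cT : closure W (x + T *: v).
  by apply: closure_segment_end WT _ _; rewrite // ltW//= lexx.
exists T; split=> //; last exact: annulus_boundary.
move=> s /andP[]; rewrite le_eqVlt => /predU1P[<- _|s0 sT].
  by rewrite scale0r addr0.
by apply: WT; rewrite s0.
Qed.

Lemma frontier_neq0 : (0 < n)%N -> exists y, frontier Dm y.
Proof.
move=> n0; have e0 : basis_vec (Ordinal n0) != 0 :> V.
  apply/eqP => /rowP/(_ (Ordinal n0)); rewrite !mxE !eqxx => /eqP.
  by rewrite oner_eq0.
have bDm : bounded_set Dm.
  have [M M0 DM] := bounded_norm (bounded_outer annW).
  exists M; split; first exact: num_real.
  move=> K MK x /subset_closure/(inner_outer annW)/DM/le_trans; apply; exact: ltW.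
have [r r0 rD] := near0_line (basis_vec (Ordinal n0)) (open_inner annW) (inner0 annW).
have [|T [rT WT nT]] := exit_point (x := 0) (open_inner annW) bDm e0 r0.
  by move=> s /andP[s0 sr]; apply: rD; rewrite gtr0_norm.
exists (0 + T *: basis_vec (Ordinal n0)); apply/frontier_open.
  exact: open_inner annW.
split=> //; have T0 := lt_le_trans r0 rT.
by apply: closure_segment_end WT _ _; rewrite // ltW//= lexx.
Qed.

End Annulus_theory.

(** * Solutions, and extrema over compact sets *)

Section Solutions.
Context {R : realType} {n : nat}.
Local Notation V := 'rV[R]_n.
Implicit Types (x y z v : V) (u psi phi : V -> R).

Record solution (W Dp Dm : set V) (nu : V -> V) psi phi (gamma : R) u : Prop :=
  Solution {
    sol_C2 : Ck 2 W u;
    sol_C1 : C1_closure W u;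
    sol_convex : strictly_convex_on W u;
    sol_det : forall x, W x -> \det (hessian u x) = psi x ^+ n;
    sol_outer : forall x, frontier Dp x -> u x = 0;
    sol_inner : forall x, frontier Dm x ->
      dotp (grad_closure W u x) (nu x) = gamma * u x + phi x }.

Lemma compact_norm_bound (W : normedModType R) (A : set V) (f : V -> W) :
  compact A -> {within A, continuous f} ->
  exists2 B : R, 0 <= B & forall x, A x -> `|f x| <= B.
Proof.
move=> cA cf; have /compact_bounded/pinfty_ex_gt0[M M0 HM] := continuous_compact cf cA.
by exists M; [exact: ltW|move=> x Ax; apply: HM; exists x].
Qed.

Lemma compact_pos_min (A : set V) (f : V -> R) : compact A ->
  (forall x, A x -> {for x, continuous f}) -> (forall x, A x -> 0 < f x) ->
  exists2 m : R, 0 < m & forall x, A x -> m <= f x.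
Proof.
move=> cA cf f0; have [A0|nA0] := pselect (A !=set0); last first.
  by exists 1 => // x Ax; case: nA0; exists x.
have wcf : {within A, continuous f}.
  by apply: continuous_in_subspaceT => x; rewrite inE; exact: cf.
have [c /set_mem Ac Hc] := EVT_min_rV A0 cA wcf.
by exists (f c); [exact: f0|move=> x Ax; apply: Hc; exact: mem_set].
Qed.

(** Dimension at least 2 supplies a direction inside every hyperplane, in particular parallel to the
    base of a cap. *)
Lemma exists_orthogonal (a : V) : (1 < n)%N -> exists2 t : V, t != 0 & dotp a t = 0.
Proof.
move=> n1; pose i0 := Ordinal (ltnW n1); pose i1 := Ordinal n1.
have dotp_basis i : dotp a (basis_vec i) = a 0 i.
  rewrite /dotp (bigD1 i)//= !mxE !eqxx mulr1 big1 ?addr0// => j ji.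
  by rewrite !mxE (negbTE ji) andbF mulr0.
have [a0|a0] := eqVneq (a 0 i0) 0.
  exists (basis_vec i0); last by rewrite dotp_basis.
  by apply/eqP => /rowP/(_ i0); rewrite !mxE !eqxx => /eqP; rewrite oner_eq0.
exists (a 0 i1 *: basis_vec i0 - a 0 i0 *: basis_vec i1).
  apply/eqP => /rowP/(_ i1); rewrite !mxE !eqxx mulr0 mulr1 sub0r => /eqP.
  by rewrite oppr_eq0 (negbTE a0).
by rewrite dotpBr !dotpZr !dotp_basis mulrC subrr.
Qed.

Lemma continuous_dotp_sqr (a : V) : continuous (fun x : V => dotp (x - a) (x - a)).
Proof.
have -> : (fun x : V => dotp (x - a) (x - a)) =
    \sum_(i < n) (fun x : V => (x 0 i - a 0 i) * (x 0 i - a 0 i)).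
  by apply/funext => x; rewrite fct_sumE; apply: eq_bigr => i _; rewrite !mxE.
move=> x; elim/big_ind : _ => [|f g cf cg|i _].
- exact: cst_continuous.
- exact: continuousD.
- have c : {for x, continuous (fun x : V => x 0 i - a 0 i)}.
    by apply: continuousB; [exact: coord_continuous|exact: cst_continuous].
  exact: (@continuousM R V _ _ x c c).
Qed.

End Solutions.

(** * Upper bound, and comparison of two solutions *)

Section Estimates.
Context {R : realType} {n : nat} (n_gt1 : (1 < n)%N).
Local Notation V := 'rV[R]_n.
Context {W Dp Dm : set V} {nu : V -> V} (annW : annulus W Dp Dm nu).
Context {psi phi : V -> R}.
Local Notation sol := (solution W Dp Dm nu psi phi).
Local Notation Gp := (frontier Dp).
Local Notation Gm := (frontier Dm).
Implicit Types (x y z v : V) (u : V -> R) (gamma : R).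

Let n_gt0 : (0 < n)%N := ltnW n_gt1.

Lemma sol_supporting gamma u x v (T : R) : sol gamma u -> closure W x -> 0 < T ->
  (forall s : R, 0 < s < T -> W (x + s *: v)) ->
  u x + T * dotp (grad_closure W u x) v <= u (x + T *: v).
Proof.
move=> S; apply: supporting_ineq; first exact: annulus_open annW.
- exact: sol_C2 S.
- exact: sol_C1 S.
- exact: sol_convex S.
Qed.

Lemma sol_supporting_rev gamma u x v (T : R) : sol gamma u -> 0 < T ->
  closure W (x + T *: v) -> (forall s : R, 0 < s < T -> W (x + s *: v)) ->
  u (x + T *: v) - T * dotp (grad_closure W u (x + T *: v)) v <= u x.
Proof.
move=> S T0 cT WT.
have := @sol_supporting _ _ (x + T *: v) (- v) T S cT T0.
rewrite dotpNr mulrN scalerN addrK; apply => s /andP[s0 sT].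
rewrite scalerN -addrA -scalerBl; apply: WT.
by rewrite subr_gt0 sT/= ltrBlDr ltrDl.
Qed.

Lemma sol_bounds gamma u : sol gamma u ->
  exists B0 B1 : R, [/\ 0 <= B0, 0 <= B1, forall x, closure W x -> `|u x| <= B0 &
    forall x, closure W x -> `|grad_closure W u x| <= B1].
Proof.
move=> S; have [cu _ _ cg] := sol_C1 S; have cW := annulus_compact annW.
have [B0 B00 H0] := compact_norm_bound cW cu.
have [B1 B10 H1] := compact_norm_bound cW cg.
by exists B0, B1.
Qed.

Lemma norm_normal y : Gm y -> `|nu y| <= 1.
Proof. by move=> Gy; apply: norm_dotp1; exact: normal1 annW _ Gy. Qed.

(** The boundary condition of one solution writes [phi] as [u_nu - gamma u], and both terms are
    bounded. *)
Lemma phi_bound gamma u : sol gamma u ->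
  exists2 P : R, 0 <= P & forall y, Gm y -> `|phi y| <= P.
Proof.
move=> S; have [B0 [B1 [B00 B10 H0 H1]]] := sol_bounds S.
exists (n%:R * B1 + `|gamma| * B0); first by rewrite addr_ge0// mulr_ge0.
move=> y Gy; have cy := inner_boundary_closure annW Gy.
have -> : phi y = dotp (grad_closure W u y) (nu y) - gamma * u y.
  by rewrite (sol_inner S Gy) addrC addKr.
rewrite (le_trans (ler_normB _ _))// lerD//.
  rewrite (le_trans (ler_norm_dotp _ _))// ler_wpM2l// -[leRHS]mulr1.
  by apply: ler_pM => //; [exact: H1|exact: norm_normal].
by rewrite normrM ler_wpM2l// H0.
Qed.

Lemma oblique_arith (T m p g a f : R) : 0 < T -> T <= m -> 0 <= p -> 0 <= g ->
  `|f| <= p -> a + T * (g * a + f) <= 0 -> a <= m * p.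
Proof.
move=> T0 Tm p0 g0; rewrite ler_norml => /andP[fp _] H.
have mp0 : 0 <= m * p by rewrite mulr_ge0// (le_trans (ltW T0)).
have [a0|a0] := leP a 0; first exact: le_trans a0 mp0.
have Tga : 0 <= T * (g * a) by rewrite !mulr_ge0// ltW.
have Tf : T * - p <= T * f by rewrite ler_wpM2l// ltW.
have Tp : T * p <= m * p by rewrite ler_wpM2r.
by rewrite mulrDr in H; lra.
Qed.

Lemma upper_bound_inner (M P : R) gamma u y :
  (forall x, closure W x -> `|x| <= M) ->
  (forall y, Gm y -> `|phi y| <= P) -> 0 <= gamma -> sol gamma u ->
  Gm y -> u y <= n%:R * (M + M) * P.
Proof.
move=> WM phiP g0 S Gy; have [d d0 dD] := inner_gap annW.
have nu1 := normal1 annW Gy.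
have nu0 : 0 < dotp (nu y) (nu y) by rewrite nu1.
have [T [T0 _ WT GT]] := outward_ray annW d0 dD Gy nu0.
have cy := inner_boundary_closure annW Gy.
have := sol_supporting S cy T0 WT.
rewrite (sol_outer S GT) (sol_inner S Gy).
apply: oblique_arith => //; last 2 first.
- exact: le_trans (normr_ge0 _) (phiP _ Gy).
- exact: phiP.
(* [T] is the component along a unit vector of a difference of two points of [closure W], each of
   norm at most [M]. *)
have -> : T = dotp (y + T *: nu y - y) (nu y).
  by rewrite addrC addKr dotpZl nu1 mulr1.
rewrite (le_trans (ler_norm _))// (le_trans (ler_norm_dotp _ _))// ler_wpM2l//.
rewrite -[leRHS]mulr1; apply: ler_pM => //; last exact: norm_normal.
rewrite (le_trans (ler_normB _ _))// lerD//; last exact: WM.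
by apply: WM; apply: closure_segment_end WT _ _; rewrite // lexx ltW.
Qed.

(** From an interior point one moves in a direction of nonnegative slope, [t] or [- t]; by convexity
    the value at the exit point is at least [u x], and on the boundary the bound is known. *)
Lemma upper_bound (M P : R) gamma u : (forall x, closure W x -> `|x| <= M) ->
  (forall y, Gm y -> `|phi y| <= P) -> 0 <= gamma -> sol gamma u ->
  forall x, closure W x -> u x <= n%:R * (M + M) * P.
Proof.
move=> WM phiP g0 S x cx.
have [y0 Gy0] := frontier_neq0 annW n_gt0.
have P0 : 0 <= P := le_trans (normr_ge0 _) (phiP _ Gy0).
have M0 : 0 <= M := le_trans (normr_ge0 _) (WM _ cx).
have U0 : 0 <= n%:R * (M + M) * P by rewrite !mulr_ge0// addr_ge0.
have bdry z : Gp z \/ Gm z -> u z <= n%:R * (M + M) * P.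
  move=> [Gz|Gz]; first by rewrite (sol_outer S Gz).
  exact: (upper_bound_inner WM phiP g0 S Gz).
have [Wx|nWx] := pselect (W x); last exact/bdry/(annulus_boundary annW).
have [t t0 _] := exists_orthogonal (0 : V) n_gt1.
wlog : t t0 / 0 <= dotp (grad_closure W u x) t.
  move=> Hw; have [H|H] := leP 0 (dotp (grad_closure W u x) t).
    exact: Hw t0 H.
  by apply: (Hw (- t)); [rewrite oppr_eq0|rewrite dotpNr oppr_ge0 ltW].
move=> gt0; have [T [T0 WT _ GT]] := interior_ray annW Wx t0.
apply: le_trans (bdry _ GT); apply: le_trans (sol_supporting S cx T0 _).
  by rewrite lerDl mulr_ge0// ltW.
by move=> s /andP[s0 sT]; apply: WT; rewrite (ltW s0).
Qed.

Lemma continuous_combination (T : topologicalType) (f g h : T -> R) :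
  continuous f -> continuous g -> continuous h ->
  continuous (fun t => f t - 2 * g t - h t).
Proof.
move=> cf cg ch t.
apply: (@continuousB _ R T (fun t => f t - 2 * g t) h); last exact: ch.
apply: (@continuousB _ R T f (fun t => 2 * g t)); first exact: cf.
by apply: (@continuousM _ T (cst 2) g); [exact: cst_continuous|exact: cg].
Qed.

Lemma compare_min gamma gamma0 u w (q : V -> R) : sol gamma u -> sol gamma0 w ->
  continuous q -> (forall x v, 2 * q x <= q (x + v) + q (x - v)) ->
  exists z, [/\ closure W z, Gp z \/ Gm z & forall x, closure W x ->
    u z - 2 * w z - q z <= u x - 2 * w x - q x].
Proof.
move=> S Sw cq mq.
have [y0 /(inner_boundary_closure annW) cy0] := frontier_neq0 annW n_gt0.
have [cu _ _ _] := sol_C1 S; have [cw _ _ _] := sol_C1 Sw.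
have cF : {within closure W, continuous (fun x => u x - 2 * w x - q x)}.
  by apply: continuous_combination => //; exact: continuous_subspaceT.
have cW0 : closure W !=set0 by exists y0.
have [z /set_mem cz Hz] := EVT_min_rV cW0 (annulus_compact annW) cF.
exists z; split=> //; last by move=> x cx; apply: Hz; exact: mem_set.
have [Wz|nWz] := pselect (W z); last exact: annulus_boundary annW _ cz nWz.
have [r r0 rW] := open_norm_ball (annulus_open annW) Wz.
exfalso; apply: (no_interior_min n_gt0 (annulus_open annW) (sol_C2 S) (sol_C2 Sw)
  (sol_convex S) (sol_convex Sw) Wz _ mq r0).
  exact: etrans (sol_det S Wz) (esym (sol_det Sw Wz)).
by move=> y /rW Wy; apply: Hz; apply: mem_set; exact: subset_closure.
Qed.

End Estimates.

(** * Lower bound by comparison with a fixed solution *)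

Section Lower_bound.
Context {R : realType} {n : nat} (n_gt1 : (1 < n)%N).
Local Notation V := 'rV[R]_n.
Context {W Dp Dm : set V} {nu : V -> V} (annW : annulus W Dp Dm nu).
Context {psi phi : V -> R}.
Local Notation sol := (solution W Dp Dm nu psi phi).
Local Notation Gp := (frontier Dp).
Local Notation Gm := (frontier Dm).
Implicit Types (x y z v : V) (u : V -> R) (gamma : R).

Lemma dotp_add_scale (a b : V) (t : R) :
  dotp (a + t *: b) (a + t *: b) = dotp a a + 2 * t * dotp a b + t ^+ 2 * dotp b b.
Proof. by rewrite !(dotpDl, dotpDr, dotpZl, dotpZr) (dotpC b a); ring. Qed.

Lemma half_sqr_midpoint (A : R) x v : 0 <= A ->
  2 * (A / 2 * dotp x x) <=
  A / 2 * dotp (x + v) (x + v) + A / 2 * dotp (x - v) (x - v).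
Proof.
have E (a b c : R) : A / 2 * (a + 2 * 1 * b + 1 ^+ 2 * c) +
    A / 2 * (a + 2 * -1 * b + (-1) ^+ 2 * c) = 2 * (A / 2 * a) + A * c by field.
move=> A0; rewrite -[v]scale1r -scaleNr !dotp_add_scale E.
by rewrite lerDl mulr_ge0// dotp_ge0.
Qed.

(** The supporting inequality taken backwards from [y + s nu y] bounds the interior slope there
    below by [k]; then [s] tends to 0. *)
Lemma normal_derivative_ge gamma u y (k T : R) : sol gamma u -> Gm y -> 0 < T ->
  (forall s : R, 0 < s < T -> W (y + s *: nu y)) ->
  (forall s : R, 0 < s < T -> u y + s * k <= u (y + s *: nu y)) ->
  k <= gamma * u y + phi y.
Proof.
move=> S Gy T0 WT H; rewrite -(sol_inner S Gy); apply/ler_addgt0Pr => e e0.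
have K0 : 0 < n%:R * `|nu y| + 1 by rewrite ltr_wpDl// mulr_ge0.
have cy := inner_boundary_closure annW Gy.
have [r r0 rg] := grad_closure_near (sol_C1 S) cy (divr_gt0 e0 K0).
have [r' r'0 rv] := small_step (nu y) r0.
have [s [s0 sr sT]] := exists_lt_both r'0 T0.
have Ws : W (y + s *: nu y) by apply: WT; rewrite s0.
apply: (@le_trans _ _ (dotp (grad u (y + s *: nu y)) (nu y))).
  have Wt (t : R) : 0 < t < s -> W (y + t *: nu y).
    by move=> /andP[t0 ts]; apply: WT; rewrite t0 (lt_trans ts).
  have := sol_supporting_rev annW S s0 (subset_closure Ws) Wt.
  have sT0 : 0 < s < T by rewrite s0.
  rewrite (grad_closure_in (sol_C1 S) Ws) lerBlDr => /(le_trans (H _ sT0)).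
  by rewrite lerD2l ler_pM2l.
by apply/dotp_le_near/rg => //; rewrite addrC addKr; apply: rv; rewrite gtr0_norm.
Qed.

(** At a minimum point [z] of [u - 2 w - q] one has [u z >= 0], so the minimum is at least [- H],
    where [H] bounds [2 w + q]; hence [u >= - 2 H]. *)
Lemma lower_bound gamma0 w : sol gamma0 w -> exists2 L : R, 0 <= L &
  forall gamma u, 0 <= gamma -> sol gamma u -> forall x, closure W x -> - L <= u x.
Proof.
have key (A B c d : R) : 0 < c -> c <= d -> 0 <= A -> A * c = B ->
  B <= A * d by move=> ? ? ? <-; rewrite ler_wpM2l.
move=> Sw; have [B0 [B1 [B00 B10 H0 H1]]] := sol_bounds annW Sw.
have [P P0 phiP] := phi_bound annW Sw.
have [c c0 Hc] := normal_origin annW; have [M M0 WM] := annulus_norm annW.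
(* A makes the normal derivative of 2 w + A |x|^2 / 2 on Gm exceed phi. *)
pose A := (2 * (n%:R * B1) + P + 1) / c.
have A0 : 0 <= A.
  by rewrite divr_ge0 ?(ltW c0)// !addr_ge0// !mulr_ge0.
pose q x := A / 2 * dotp x x.
pose H := 2 * B0 + A / 2 * (n%:R * (M * M)).
have A20 : 0 <= A / 2 by rewrite divr_ge0.
have H00 : 0 <= H.
  apply: addr_ge0; first exact: mulr_ge0.
  by apply: mulr_ge0 => //; rewrite !mulr_ge0// ltW.
have hH x : closure W x -> `|2 * w x + q x| <= H.
  move=> cx; rewrite (le_trans (ler_normD _ _))// lerD//.
    by rewrite normrM ger0_norm// ler_wpM2l// H0.
  rewrite normrM ger0_norm// ler_wpM2l//.
  rewrite (le_trans (ler_norm_dotp _ _))// ler_wpM2l//.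
  by apply: ler_pM; rewrite ?WM.
exists (H + H) => [|gamma u g0 S x cx]; first exact: addr_ge0.
have cq : continuous q.
  move=> y; apply: (@continuousM _ V (cst (A / 2)) (fun y => dotp y y)).
    exact: cst_continuous.
  have -> : (fun y : V => dotp y y) = (fun y : V => dotp (y - 0) (y - 0)).
    by apply/funext => t; rewrite subr0.
  exact: continuous_dotp_sqr.
have mq y v : 2 * q y <= q (y + v) + q (y - v) by exact: half_sqr_midpoint.
have [z [cz Gz Hz]] := compare_min n_gt1 annW S Sw cq mq.
(* If [u z < 0] then [z] lies on the inner boundary and [gamma * u z <= 0], so the normal derivative
   is at most [phi z <= P]; minimality forces it to be at least [k >= P + 1]. *)
have uz0 : 0 <= u z.
  case: Gz => Gz; first by rewrite (sol_outer S Gz).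
  have nu1 := normal1 annW Gz.
  have nu0 : 0 < dotp (nu z) (nu z) by rewrite nu1.
  have [d d0 dD] := inner_gap annW.
  have [T [T0 _ WT _]] := outward_ray annW d0 dD Gz nu0.
  pose k := 2 * dotp (grad_closure W w z) (nu z) + A * dotp z (nu z).
  have kge : P + 1 <= k.
    have h1 : - (n%:R * B1) <= dotp (grad_closure W w z) (nu z).
      suff : `|dotp (grad_closure W w z) (nu z)| <= n%:R * B1.
        by rewrite ler_norml => /andP[].
      rewrite (le_trans (ler_norm_dotp _ _))// ler_wpM2l// -[leRHS]mulr1.
      by apply: ler_pM => //; [exact: H1|exact: (norm_normal annW)].
    have h2 : 2 * (n%:R * B1) + P + 1 <= A * dotp z (nu z).
      rewrite (dotpC z); apply: (key _ _ _ _ c0 (Hc _ Gz) A0).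
      by rewrite /A divfK// gt_eqF.
    rewrite /k; move: h1 h2.
    by clear; move: (dotp _ _) (A * _) (n%:R * _) => a b e; lra.
  have := normal_derivative_ge (k := k) S Gz T0 WT _.
  have Hk (s : R) : 0 < s < T -> u z + s * k <= u (z + s *: nu z).
    move=> /[dup] sT /andP[s0 s1].
    have Ws := subset_closure (WT _ sT).
    have hw : w z + s * dotp (grad_closure W w z) (nu z) <= w (z + s *: nu z).
      apply: (sol_supporting annW Sw cz s0) => t /andP[t0 ts].
      by apply: WT; rewrite t0 (lt_trans ts).
    have hq : q z + s * (A * dotp z (nu z)) <= q (z + s *: nu z).
      rewrite /q dotp_add_scale nu1.
      have E (a b : R) : A / 2 * (a + 2 * s * b + s ^+ 2 * 1) =
        A / 2 * a + s * (A * b) + A / 2 * s ^+ 2 by field.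
      by rewrite E lerDl mulr_ge0// sqr_ge0.
    move: (Hz _ Ws) hw hq; rewrite /k; clear.
    move: (u z) (w z) (q z) (u _) (w _) (q _) (dotp _ _) (A * _).
    by move=> a1 a2 a3 a4 a5 a6 a7 a8; lra.
  move=> /(_ Hk)/(le_trans kge) gu.
  have := phiP _ Gz; rewrite ler_norml => /andP[_ phz].
  rewrite leNgt; apply/negP => uz.
  have : gamma * u z <= 0 by rewrite mulr_ge0_le0// ltW.
  move: gu phz; clear; move: (gamma * _) (phi z) => a b; lra.
have := Hz _ cx; have := hH _ cx; have := hH _ cz.
rewrite !ler_norml => /andP[+ +] /andP[+ +]; move: uz0; clear.
move: (u z) (w z) (q z) (u x) (w x) (q x) H => a1 a2 a3 a4 a5 a6 a7; lra.
Qed.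

End Lower_bound.

(** * Gradient at a maximum point on the inner boundary, and the sign of [u] on caps *)

Section Coefficient_bound.
Context {R : realType} {n : nat} (n_gt1 : (1 < n)%N).
Local Notation V := 'rV[R]_n.
Context {W Dp Dm : set V} {nu : V -> V} (annW : annulus W Dp Dm nu).
Context {psi phi : V -> R}.
Local Notation sol := (solution W Dp Dm nu psi phi).
Local Notation Gp := (frontier Dp).
Local Notation Gm := (frontier Dm).
Implicit Types (x y z v : V) (u : V -> R) (gamma : R).

(* By strict convexity y + k v lies in W for small k > 0; moving from there
   towards the origin one meets Gm after a distance o(k), at a point where u is
   at most u y. *)
Lemma tangential_slope gamma u y v (c e : R) : sol gamma u -> Gm y ->
  (forall z, Gm z -> u z <= u y) -> v != 0 -> dotp (nu y) v = 0 ->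
  0 < c -> 0 < e -> exists Q (h : R), [/\ W Q, `|Q - y| < e, 0 < h <= c &
    dotp (grad_closure W u y) v <= h * dotp (grad u Q) y].
Proof.
move=> S Gy ymax v0 yv c0 e0; have [d d0 dD] := inner_gap annW.
have cDy : closure Dm y by case: Gy.
have cy := inner_boundary_closure annW Gy.
have [c1 c10 Hc1] := normal_origin annW.
have nuy : 0 < dotp (nu y) y := lt_le_trans c10 (Hc1 _ Gy).
have y0 : y != 0 by apply: contraTneq nuy => ->; rewrite dotp0 ltxx.
have [r1 r10 Hr1] := inner_tangent annW Gy v0 yv.
(* Tilting the tangent direction towards the origin by any [c > 0] makes it enter [Dm]. *)
have [|r2 r20 Hr2] := inner_transversal annW (v := v - c *: y) Gy.
  by rewrite dotpBr yv dotpZr sub0r oppr_lt0 mulr_gt0.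
have d20 : 0 < d / 2 by rewrite divr_gt0.
have [r3 r30 Hr3] := small_step v e0.
have [r4 r40 Hr4] := small_step v d20.
have [r5 r50 Hr5] := small_step (c *: y) d20.
pose m := Num.min r1 (Num.min r2 (Num.min r3 (Num.min r4 r5))).
have m0 : 0 < m by rewrite !lt_min r10 r20 r30 r40.
pose k := m / 2; have k0 : 0 < k by rewrite divr_gt0.
have : k < m by rewrite /k ltr_pdivrMr// mulr_natr mulr2n ltrDl.
rewrite !lt_min => /andP[k1 /andP[k2 /andP[k3 /andP[k4 k5]]]].
have nk (r : R) : k < r -> `|k| < r by rewrite gtr0_norm.
have dd2 : d / 2 < d by rewrite ltr_pdivrMr// mulr_natr mulr2n ltrDl.
have Wk (s : R) : 0 < s <= k -> W (y + s *: v).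
  move=> /andP[s0 sk]; rewrite (annulusE annW); split.
    apply: dD => //; apply: lt_trans dd2; apply: Hr4.
    by rewrite gtr0_norm// (le_lt_trans sk).
  by apply: Hr1; rewrite s0 (le_lt_trans sk).
pose Q := y + k *: v.
have WQ : W Q by apply: Wk; rewrite k0 lexx.
have ny0 : - y != 0 by rewrite oppr_eq0.
have [T [T0 WT cT GT]] := interior_ray annW WQ ny0.
(* At parameter [k * c] the segment from [Q] is at [y + k (v - c y)], already in [Dm]. *)
have Tkc : T <= k * c.
  rewrite leNgt; apply/negP => kcT.
  have := WT (k * c); rewrite mulr_ge0 ?ltW//= => /(_ kcT).
  have -> : Q + (k * c) *: - y = y + k *: (v - c *: y).
    by rewrite /Q scalerBr scalerA addrA scalerN.
  move=> /(annulus_notin annW); apply; apply: subset_closure; apply: Hr2.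
  by rewrite k0.
(* The exit point is within [d] of [y], hence in [Dp], so it is on the inner boundary, where [u y]
   is the maximum. *)
have uP : u (Q + T *: - y) <= u y.
  case: GT => [/(frontier_open _ (open_outer annW))[_]|]; last exact: ymax.
  case; rewrite /Q -addrA; apply: dD => //.
  rewrite (le_lt_trans (ler_normD _ _))// (splitr d) ltrD// ?Hr4 ?nk//.
  rewrite scalerN normrN; apply: le_lt_trans (Hr5 _ (nk _ k5)).
  by rewrite scalerA !normrZ ler_wpM2r// !ger0_norm ?mulr_ge0// ltW.
exists Q, (T / k); split=> //.
- by rewrite /Q addrC addKr; apply: Hr3; exact: nk.
- by rewrite divr_gt0// ler_pdivrMr// mulrC.
have h1 : u y + k * dotp (grad_closure W u y) v <= u Q.
  by apply: (sol_supporting annW S cy k0) => s /andP[s0 sk]; apply: Wk; rewrite s0 ltW.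
have h2 : u Q + T * dotp (grad u Q) (- y) <= u (Q + T *: - y).
  rewrite -(grad_closure_in (sol_C1 S) WQ).
  apply: (sol_supporting annW S (subset_closure WQ) T0) => s /andP[s0 sT].
  by apply: WT; rewrite ltW.
rewrite -(ler_pM2l k0) mulrA (mulrCA k) divff ?gt_eqF// mulr1.
have := le_trans h2 uP; rewrite dotpNr mulrN lerBlDr.
move: h1; clear; move: (u y) (u Q) (k * _) (T * _) => a b p q; lra.
Qed.

(** [tangential_slope] with [c] tending to 0, for [v] and [- v], makes all tangential slopes vanish.
    With the sign of the slope along [y], [half_space_normal] yields a nonnegative multiple of
    [nu y]. *)
Lemma argmax_gradient gamma u y : sol gamma u -> Gm y ->
  (forall z, Gm z -> u z <= u y) ->
  exists2 k : R, 0 <= k & grad_closure W u y = k *: nu y.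
Proof.
move=> S Gy ymax; have [B0 [B1 [B00 B10 H0 H1]]] := sol_bounds annW S.
have cy := inner_boundary_closure annW Gy.
have tangent_le0 v : dotp (nu y) v = 0 -> dotp (grad_closure W u y) v <= 0.
  have [->|v0] := eqVneq v 0; first by rewrite !dotp0.
  move=> yv; apply/ler_addgt0Pr => e e0; rewrite add0r.
  pose b := n%:R * (B1 * `|y|) + 1.
  have b0 : 0 < b by rewrite ltr_wpDl// !mulr_ge0.
  have [Q [h [WQ _ /andP[h0 hc] Hh]]] :=
    tangential_slope S Gy ymax v0 yv (divr_gt0 e0 b0) ltr01.
  apply: le_trans Hh _.
  have gQ : dotp (grad u Q) y <= b.
    rewrite (le_trans (ler_norm _))// (le_trans (ler_norm_dotp _ _))//.
    rewrite -(grad_closure_in (sol_C1 S) WQ) /b ler_wpDr// ler_wpM2l//.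
    by rewrite ler_wpM2r// H1//; exact: subset_closure.
  rewrite (le_trans (ler_wpM2l (ltW h0) gQ))//.
  by rewrite -ler_pdivlMr.
have tangent0 v : dotp (nu y) v = 0 -> dotp (grad_closure W u y) v = 0.
  move=> yv; apply/eqP; rewrite eq_le tangent_le0//=.
  by rewrite -oppr_le0 -dotpNr tangent_le0// dotpNr yv oppr0.
have [c1 c10 Hc1] := normal_origin annW.
have nuy : 0 < dotp (nu y) y := lt_le_trans c10 (Hc1 _ Gy).
(* In [tangential_slope] the left side is now 0 and [h > 0], so [grad u Q] has nonnegative product
   with [y]; then [Q] tends to [y]. *)
have gy : 0 <= dotp (grad_closure W u y) y.
  have [t t0 yt] := exists_orthogonal (nu y) n_gt1.
  apply/ler_addgt0Pr => e e0.
  have K0 : 0 < n%:R * `|y| + 1 by rewrite ltr_wpDl// mulr_ge0.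
  have [r r0 rg] := grad_closure_near (sol_C1 S) cy (divr_gt0 e0 K0).
  have [Q [h [WQ Qy /andP[h0 _]]]] := tangential_slope S Gy ymax t0 yt ltr01 r0.
  rewrite tangent0// pmulr_rge0// => /le_trans; apply.
  by apply/dotp_le_near/rg.
have nu1 := normal1 annW Gy.
have nun0 : nu y != 0 by rewrite -dotp_eq0 nu1 oner_eq0.
apply: half_space_normal => // v yv.
pose c := dotp (nu y) v / dotp (nu y) y.
have c0 : c <= 0 by rewrite mulr_le0_ge0 ?invr_ge0// ltW.
have : dotp (grad_closure W u y) (v - c *: y) = 0.
  by apply: tangent0; rewrite dotpBr dotpZr /c divfK ?subrr// gt_eqF.
rewrite dotpBr dotpZr => /eqP; rewrite subr_eq0 => /eqP ->.
exact: mulr_le0_ge0.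
Qed.

(** A line through [x] orthogonal to [nu y] stays on the positive side of the tangent hyperplane, so
    it exits where [u = 0]; it is followed in a direction of nonnegative slope. *)
Lemma cap_le0 gamma u x y : sol gamma u -> Gm y -> W x -> 0 < dotp (nu y) (x - y) ->
  u x <= 0.
Proof.
move=> S Gy Wx xy; have [t t0 yt] := exists_orthogonal (nu y) n_gt1.
wlog : t t0 yt / 0 <= dotp (grad_closure W u x) t.
  move=> Hw; have [H|H] := leP 0 (dotp (grad_closure W u x) t).
    exact: Hw t0 yt H.
  by apply: (Hw (- t)); rewrite ?oppr_eq0 ?dotpNr ?yt ?oppr0// oppr_ge0 ltW.
move=> gt0; have [T [T0 WT cT GT]] := interior_ray annW Wx t0.
have {}GT : Gp (x + T *: t).
  case: GT => // -[/(inner_support annW Gy) + _].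
  by rewrite addrAC dotpDr dotpZr yt mulr0 addr0 leNgt xy.
rewrite -(sol_outer S GT).
apply: le_trans (sol_supporting annW S (subset_closure Wx) T0 _).
  by rewrite lerDl mulr_ge0// ltW.
by move=> s /andP[s0 sT]; apply: WT; rewrite (ltW s0).
Qed.

End Coefficient_bound.

(** * Bound on the coefficient of the oblique condition *)

Section Gradient_bound.
Context {R : realType} {n : nat} (n_gt1 : (1 < n)%N).
Local Notation V := 'rV[R]_n.
Context {W Dp Dm : set V} {nu : V -> V} (annW : annulus W Dp Dm nu).
Context {psi phi : V -> R}.
Local Notation sol := (solution W Dp Dm nu psi phi).
Local Notation Gp := (frontier Dp).
Local Notation Gm := (frontier Dm).
Implicit Types (x y z v : V) (u : V -> R) (gamma : R).

(** On this compact part of [W] the positive continuous [psi] has a positive lower bound. *)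
Lemma eroded_compact (r : R) : 0 < r ->
  compact [set x : V | forall z, `|z - x| < r -> W z].
Proof.
move=> r0; have sub x : (forall z, `|z - x| < r -> W z) -> W x.
  by apply; rewrite subrr normr0.
apply: bounded_closed_compact.
  have [M M0 WM] := annulus_norm annW; exists M; split; first exact: num_real.
  move=> K MK x /sub/subset_closure/WM/le_trans; apply; exact: ltW.
move=> x cx z zx; have e0 : 0 < r - `|z - x| by rewrite subr_gt0.
have [x' Wx' xx'] := (closure_norm _ _).2 cx _ e0.
apply: Wx'; apply: (le_lt_trans (ler_distD x _ _)).
by rewrite (distrC x) -ltrBrDl.
Qed.

Lemma closed_ball_compact (a : V) (r : R) : compact [set x : V | `|x - a| <= r].
Proof.
apply: bounded_closed_compact.
  exists (r + `|a|); split; first exact: num_real.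
  move=> K MK x xa; apply: (@le_trans _ _ (`|x - a| + `|a|)).
    by have := ler_normD (x - a) a; rewrite subrK.
  by apply: le_trans (ltW MK); rewrite lerD2r.
move=> x cx; apply/ler_addgt0Pr => e e0.
have [y ya yx] := (closure_norm _ _).2 cx _ e0.
apply: (le_trans (ler_distD y _ _)); rewrite addrC lerD//.
by rewrite distrC; exact: ltW.
Qed.

Lemma inner_boundary_compact : compact Gm.
Proof.
apply: subclosed_compact (annulus_compact annW) _; last first.
  by move=> y; exact: inner_boundary_closure annW _.
rewrite /frontier setDE; apply: closedI; first exact: closed_closure.
by apply: open_closedC; exact: open_interior.
Qed.

(** With [u y <= - k] at the maximum point [y], the sign of the normal slope gives [0 <= gamma * u y
    + phi y <= - gamma * k + P]. *)
Lemma gamma_bound (P : R) : smooth W psi -> (forall x, W x -> 0 < psi x) ->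
  (forall y, Gm y -> `|phi y| <= P) ->
  exists G : R, forall gamma u, 0 <= gamma -> sol gamma u -> gamma <= G.
Proof.
move=> psiS psi0 phiP; have [d d0 dD] := inner_gap annW.
(* The ball of radius [3 h] about [y + (d / 2) nu y] must lie in the cap: [3 n h < d / 2] keeps it
   beyond the tangent hyperplane, and [d / 2 + 3 h < d] keeps it in [Dp]. *)
have [h h0 [nh hd]] : exists2 h : R, 0 < h & n%:R * h <= d / 8 /\ h <= d / 8.
  pose N : R := n%:R + 1; have N0 : 0 < N by rewrite ltr_wpDl.
  exists (d / (8 * N)); first by rewrite divr_gt0// mulr_gt0.
  have h0 : 0 <= d / (8 * N) by rewrite divr_ge0 ?mulr_ge0// ltW.
  have Nh : N * (d / (8 * N)) = d / 8 by field; exact: lt0r_neq0.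
  rewrite -[in X in _ <= X /\ _]Nh -[in X in _ /\ _ <= X]Nh.
  by split; [apply: ler_wpM2r => //; rewrite lerDl|apply: ler_peMl => //; rewrite lerDr].
have capW y w : Gm y -> `|w| < 3 * h ->
    W (y + (d / 2) *: nu y + w) /\ 0 < dotp (nu y) (y + (d / 2) *: nu y + w - y).
  move=> Gy wh; have nu1 := normal1 annW Gy; have nn := norm_normal annW Gy.
  have d20 : 0 < d / 2 by rewrite divr_gt0.
  have pos : 0 < dotp (nu y) (y + (d / 2) *: nu y + w - y).
    rewrite -(addrA y) addrAC subrr add0r dotpDr dotpZr nu1 mulr1.
    have : `|dotp (nu y) w| <= 3 * (n%:R * h).
      rewrite mulrCA (le_trans (ler_norm_dotp _ _))// ler_wpM2l//.
      by rewrite -[leRHS]mul1r; apply: ler_pM => //; exact: ltW.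
    rewrite ler_norml => /andP[+ _]; move: d0 nh; clear.
    by move: (dotp _ w) (n%:R * h) => a b; lra.
  split=> //; rewrite (annulusE annW); split.
    rewrite -addrA; apply: dD; first by case: Gy.
    rewrite (le_lt_trans (ler_normD _ _))// normrZ gtr0_norm//.
    have : d / 2 * `|nu y| <= d / 2 by rewrite ler_piMr// ltW.
    by move: wh hd d0; clear; move: `|w| (d / 2 * _) => a b; lra.
  by move=> /(inner_support annW Gy); rewrite leNgt pos.
have [m m0 Hm] : exists2 m : R, 0 < m &
    forall x, (forall z, `|z - x| < h -> W z) -> m <= psi x.
  have sub x : (forall z, `|z - x| < h -> W z) -> W x.
    by apply; rewrite subrr normr0.
  apply: (compact_pos_min (eroded_compact h0)) => x /sub Wx; last exact: psi0.
  by have [c _] := psiS 0%N; exact: c.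
(* The height at distance [2 h] of the paraboloid with Hessian [m / 2] times the identity. *)
pose k := m / 2 / 2 * (2 * h) ^+ 2.
have k0 : 0 < k by rewrite mulr_gt0 ?divr_gt0// exprn_gt0// mulr_gt0.
exists (P / k) => gamma u g0 S; rewrite ler_pdivlMr//.
have [cu _ _ _] := sol_C1 S.
have GmW : Gm `<=` closure W by move=> y; exact: inner_boundary_closure annW _.
have [y0 Gy0] := frontier_neq0 annW (ltnW n_gt1).
have [y /set_mem Gy ymax] := EVT_max_rV (ex_intro _ y0 Gy0) inner_boundary_compact
  (continuous_subspaceW GmW cu).
have {}ymax z : Gm z -> u z <= u y by move=> Gz; apply: ymax; exact: mem_set.
(* On the cap cut off by the tangent hyperplane at y, u y <= u <= 0, so that
   u y cannot be close to 0: u has to bend by at least k in a ball of the cap. *)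
have [a a0 ga] := argmax_gradient n_gt1 annW S Gy ymax.
have nu1 := normal1 annW Gy; have cy := GmW _ Gy.
have inner : 0 <= gamma * u y + phi y.
  by rewrite -(sol_inner S Gy) ga dotpZl nu1 mulr1.
pose x1 : V := y + (d / 2) *: nu y.
have ux1 : u y <= u x1.
  apply: le_trans (sol_supporting annW S cy (divr_gt0 d0 (ltr0n _ 2)) _).
    by rewrite ga dotpZl nu1 mulr1 lerDl mulr_ge0// divr_ge0// ltW.
  move=> s /andP[s0 sd]; rewrite (annulusE annW); split.
    apply: dD; first by case: Gy.
    rewrite normrZ gtr0_norm// (@le_lt_trans _ _ s)//.
      by rewrite ler_piMr ?(norm_normal annW)// ltW.
    by rewrite (lt_trans sd)// ltr_pdivrMr// mulr_natr mulr2n ltrDl.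
  by apply: (ray_notin annW) => //; rewrite nu1.
have ballW z : `|z - x1| < 3 * h -> W z /\ 0 < dotp (nu y) (z - y).
  by move=> /(capW _ _ Gy); rewrite -/x1 (addrC x1) subrK.
pose Bl : set V := [set x : V | `|x - x1| <= 2 * h].
have h23 : 2 * h < 3 * h by rewrite ltr_pM2r// ltr_nat.
have BlW : Bl `<=` closure W.
  by move=> x Bx; apply/subset_closure/(ballW _ _).1; exact: le_lt_trans h23.
have cF : {within Bl, continuous (fun x => u x - m / 2 / 2 * dotp (x - x1) (x - x1))}.
  move=> t; apply: (@continuousB _ R (subspace Bl) u
    (fun x => m / 2 / 2 * dotp (x - x1) (x - x1))).
    exact: (continuous_subspaceW BlW cu).
  apply: continuous_subspaceT => x.
  apply: (@continuousM _ V (cst (m / 2 / 2)) (fun x => dotp (x - x1) (x - x1))).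
    exact: cst_continuous.
  exact: continuous_dotp_sqr.
have Blx1 : Bl x1 by rewrite /Bl /= subrr normr0 mulr_ge0// ltW.
have Bl0 : Bl !=set0 by exists x1.
have [z /set_mem Bz zmax] := EVT_max_rV Bl0
  (@closed_ball_compact x1 (2 * h)) cF.
have {}zmax x : Bl x -> u x - m / 2 / 2 * dotp (x - x1) (x - x1) <=
    u z - m / 2 / 2 * dotp (z - x1) (z - x1).
  by move=> Bx; apply: zmax; exact: mem_set.
have [Wz yz] := ballW _ (le_lt_trans Bz h23).
have m20 : 0 < m / 2 by rewrite divr_gt0.
(* A maximum inside the ball would give [psi z <= m / 2], although [psi z >= m], since the [h]-ball
   about [z] lies in [W]. So [z] is on the sphere, where the paraboloid is at least [k] high. *)
have [zlt|zge] := ltP `|z - x1| (2 * h).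
  exfalso; have r0 : 0 < 2 * h - `|z - x1| by rewrite subr_gt0.
  have := det_hessian_le (ltnW n_gt1) (annulus_open annW) (sol_C2 S)
    (sol_convex S) Wz r0 _.
  rewrite (sol_det S Wz) => /(_ (m / 2) x1) H.
  have {}H : psi z ^+ n <= (m / 2) ^+ n.
    apply: H => t tz; apply: zmax; rewrite /Bl /=.
    rewrite (le_trans (ler_distD z _ _))// -lerBrDr; exact: ltW.
  have mz : m <= psi z.
    apply: Hm => t tz; apply: (ballW _ _).1.
    rewrite (le_lt_trans (ler_distD z _ _))//.
    have -> : 3 * h = h + 2 * h by rewrite -[X in X + _]mul1r -mulrDl.
    by rewrite ltr_leD.
  have : m / 2 < psi z.
    by rewrite (lt_le_trans _ mz)// ltr_pdivrMr// mulr_natr mulr2n ltrDl.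
  rewrite -(@ltr_pXn2r _ n) ?nnegrE ?(ltW m20) ?(ltnW n_gt1)//; last exact/ltW/psi0.
  by rewrite ltNge H.
have uz : u z <= 0 := cap_le0 n_gt1 annW S Gy Wz yz.
have kz : k <= m / 2 / 2 * dotp (z - x1) (z - x1).
  rewrite /k; apply: ler_wpM2l; first by rewrite divr_ge0// ltW.
  apply: le_trans (sqr_norm_le_dotp _); rewrite lerXn2r ?nnegrE//.
  by rewrite mulr_ge0// ltW.
have uyk : u y <= - k.
  have := zmax _ Blx1; rewrite subrr dotp0 mulr0 subr0 => /(le_trans ux1).
  by move: uz kz; clear; move: (u y) (u z) (_ * dotp _ _) k => p q r s; lra.
have guy : gamma * u y <= gamma * - k by rewrite ler_wpM2l.
have := phiP _ Gy; rewrite ler_norml => /andP[_].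
move: guy inner; rewrite mulrN; clear.
by move: (gamma * u y) (gamma * k) (phi y) => p q r; lra.
Qed.

End Gradient_bound.

(** * Barriers at the two boundaries and the gradient bound *)

Section A_priori_estimates.
Context {R : realType} {n : nat} (n_gt1 : (1 < n)%N).
Local Notation V := 'rV[R]_n.
Context {W Dp Dm : set V} {nu : V -> V} (annW : annulus W Dp Dm nu).
Context {psi phi : V -> R}.
Local Notation sol := (solution W Dp Dm nu psi phi).
Local Notation Gp := (frontier Dp).
Local Notation Gm := (frontier Dm).
Implicit Types (x y z v : V) (u : V -> R) (gamma : R).

(** By [compare_min] only boundary points matter. On the outer one [u] and [w] vanish and [q <= 0];
    on the inner one [q <= - (C0 + 2 B0)], which outweighs [u - 2 w]. *)
Lemma outer_barrier (C0 B0 d : R) gamma gamma0 u w y N : 0 < d ->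
  (forall z w, closure Dm z -> `|w| < d -> Dp (z + w)) ->
  sol gamma u -> sol gamma0 w -> Gp y -> dotp N N = 1 ->
  (forall z, closure Dp z -> dotp N (z - y) <= 0) ->
  (forall x, closure W x -> `|u x| <= C0) ->
  (forall x, closure W x -> `|w x| <= B0) ->
  forall x, closure W x ->
    2 * w x + (C0 + 2 * B0) / (d / 2) * dotp N (x - y) <= u x.
Proof.
move=> d0 dD S Sw Gy N1 HN HC HB x cx; set A := (C0 + 2 * B0) / (d / 2).
have C00 : 0 <= C0 := le_trans (normr_ge0 _) (HC _ cx).
have B00 : 0 <= B0 := le_trans (normr_ge0 _) (HB _ cx).
have d20 : 0 < d / 2 by rewrite divr_gt0.
have A0 : 0 <= A by rewrite divr_ge0 ?addr_ge0 ?mulr_ge0// ltW.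
pose q x := A * dotp N (x - y).
have cq : continuous q.
  move=> t; apply: (@continuousM _ V (cst A) (fun x => dotp N (x - y))).
    exact: cst_continuous.
  have -> : (fun x => dotp N (x - y)) = (fun x => dotp N x - dotp N y).
    by apply/funext => s; rewrite dotpBr.
  apply: (@continuousB _ R V (dotp N) (cst (dotp N y))).
    exact: continuous_dotp.
  exact: cst_continuous.
have mq z v : 2 * q z <= q (z + v) + q (z - v).
  rewrite /q (addrAC z v) (addrAC z (- v)).
  rewrite (dotpDr N (z - y) v) (dotpDr N (z - y) (- v)) dotpNr.
  by rewrite le_eqVlt; apply/orP; left; apply/eqP; ring.
have [z [cz Gz Hz]] := compare_min n_gt1 annW S Sw cq mq.
suff F0 : 0 <= u z - 2 * w z - q z.
  move: (le_trans F0 (Hz _ cx)); rewrite -/(q x); clear.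
  by move: (u x) (w x) (q x) => a b c; lra.
case: Gz => Gz.
  rewrite (sol_outer S Gz) (sol_outer Sw Gz) mulr0 subrr sub0r oppr_ge0.
  by rewrite /q mulr_ge0_le0// HN//; case: Gz.
have qz : q z <= - (C0 + 2 * B0).
  (* [z + (d / 2) N] is still in [Dp], so the supporting inequality holds there too. *)
  have : dotp N (z - y) <= - (d / 2).
    have cDz : closure Dm z by case: Gz.
    have Nd : `|(d / 2) *: N| < d.
      rewrite normrZ gtr0_norm// (@le_lt_trans _ _ (d / 2))//.
        by rewrite ler_piMr ?norm_dotp1// ltW.
      by rewrite ltr_pdivrMr// mulr_natr mulr2n ltrDl.
    have := HN _ (subset_closure (dD _ _ cDz Nd)).
    by rewrite addrAC (dotpDr N (z - y)) dotpZr N1 mulr1 -lerBrDr sub0r.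
  move=> /(ler_wpM2l A0); rewrite mulrN {2}/A divfK//.
  by rewrite gt_eqF.
move: (HC _ cz) (HB _ cz) qz; rewrite !ler_norml => /andP[+ _] /andP[_ +]; clear.
by move: (u z) (w z) (q z) => a b c; lra.
Qed.

(** [u] and the barrier both vanish at the exit point. Convexity gives [T] times the slope at most
    [- u x], the barrier bounds [- u x], and the boundary slope of [w] bounds [- w x]; each bound is
    linear in [T]. *)
Lemma outer_slope gamma0 w (C0 : R) : 0 <= C0 -> sol gamma0 w ->
  exists2 K : R, 0 <= K & forall gamma u x v (T : R), sol gamma u ->
    (forall x, closure W x -> `|u x| <= C0) -> 0 < T ->
    (forall s : R, 0 <= s < T -> W (x + s *: v)) -> Gp (x + T *: v) ->
    closure W (x + T *: v) -> dotp (grad u x) v <= K * `|v|.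
Proof.
move=> C00 Sw; have [B0 [B1 [B00 B10 HB0 HB1]]] := sol_bounds annW Sw.
have [d d0 dD] := inner_gap annW.
pose A := (C0 + 2 * B0) / (d / 2).
have d20 : 0 < d / 2 by rewrite divr_gt0.
have A0 : 0 <= A by rewrite divr_ge0 ?addr_ge0 ?mulr_ge0// ltW.
exists (2 * (n%:R * B1) + A * n%:R).
  by apply: addr_ge0; apply: mulr_ge0 => //; apply: mulr_ge0.
move=> gamma u x v T S HC T0 WT GT cT.
have Wx : W x by have := WT 0; rewrite lexx T0 scale0r addr0; apply.
have cx := subset_closure Wx.
have WT' (s : R) : 0 < s < T -> W (x + s *: v).
  by move=> /andP[s0 sT]; apply: WT; rewrite (ltW s0).
have [N N1 HN] := outer_support annW GT.
have low := outer_barrier d0 dD S Sw GT N1 HN HC HB0 cx.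
rewrite -/A opprD addrA subrr sub0r dotpNr dotpZr in low.
have hw := sol_supporting_rev annW Sw T0 cT WT'; rewrite (sol_outer Sw GT) sub0r in hw.
have hu := sol_supporting annW S cx T0 WT'.
rewrite (sol_outer S GT) (grad_closure_in (sol_C1 S) Wx) in hu.
have Nv : dotp N v <= n%:R * `|v|.
  rewrite (le_trans (ler_norm _))// (le_trans (ler_norm_dotp _ _))// ler_wpM2l//.
  by rewrite ler_piMl// norm_dotp1.
have gv : dotp (grad_closure W w (x + T *: v)) v <= n%:R * (B1 * `|v|).
  rewrite (le_trans (ler_norm _))// (le_trans (ler_norm_dotp _ _))// ler_wpM2l//.
  by rewrite ler_wpM2r// HB1.
rewrite -(ler_pM2l T0).
have {}Nv : T * (A * dotp N v) <= T * (A * (n%:R * `|v|)).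
  by rewrite ler_wpM2l ?(ltW T0)// ler_wpM2l.
have {}gv := ler_wpM2l (ltW T0) gv.
have -> : T * ((2 * (n%:R * B1) + A * n%:R) * `|v|) =
    2 * (T * (n%:R * (B1 * `|v|))) + T * (A * (n%:R * `|v|)) by ring.
rewrite mulrN (mulrCA A) in low.
move: low hw hu Nv gv; clear.
move: (u x) (w x) (T * (A * dotp _ _)) (T * dotp (grad_closure _ _ _) _)
  (T * dotp (grad _ _) _) (T * (A * (n%:R * _))) (T * (n%:R * _)).
by move=> a b c e f g k; lra.
Qed.

(** The ray reaches the outer boundary, where [u = 0], after length at least [d], and on it [u]
    rises by at most [C0]. *)
Lemma inner_slope : exists2 d : R, 0 < d & forall (C0 : R) gamma u y v,
  sol gamma u -> (forall x, closure W x -> `|u x| <= C0) -> Gm y ->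
  0 < dotp (nu y) v -> dotp (grad_closure W u y) v <= C0 / d * `|v|.
Proof.
have [d d0 dD] := inner_gap annW; exists d => // C0 gamma u y v S HC Gy yv.
have [T [T0 dT WT GT]] := outward_ray annW d0 dD Gy yv.
have cy := inner_boundary_closure annW Gy.
have := sol_supporting annW S cy T0 WT; rewrite (sol_outer S GT).
have C00 : 0 <= C0 := le_trans (normr_ge0 _) (HC _ cy).
have := HC _ cy; rewrite ler_norml => /andP[uy _] H.
have {}H : T * dotp (grad_closure W u y) v <= C0.
  by move: H uy; clear; move: (u y) (T * _) => a b; lra.
rewrite -(ler_pM2l T0) (le_trans H)// mulrCA mulrAC -mulrA.
by rewrite ler_peMr// ler_pdivlMr// mul1r.
Qed.

(** Convexity bounds the slope at [x] by the slope at the exit point. [outer_slope] treats an exit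
    on the outer boundary; points of the boundary itself follow by a limit. *)
Lemma gradient_bound gamma0 w (C0 P G : R) : 0 <= C0 -> 0 <= P -> 0 <= G ->
  sol gamma0 w -> (forall y, Gm y -> `|phi y| <= P) ->
  exists2 C : R, 0 <= C & forall gamma u x v, 0 <= gamma <= G -> sol gamma u ->
    (forall x, closure W x -> `|u x| <= C0) -> closure W x ->
    dotp (grad_closure W u x) v <= C * `|v|.
Proof.
move=> C00 P0 G0 Sw phiP; have [K K0 HK] := outer_slope C00 Sw.
have [d d0 Hd] := inner_slope.
pose D := C0 / d * (n%:R + 2) + (n%:R + 1) * (G * C0 + P).
have D0 : 0 <= D.
  rewrite addr_ge0 ?mulr_ge0 ?addr_ge0 ?mulr_ge0 ?divr_ge0 ?invr_ge0//; exact: ltW.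
have in_bound gamma u x v : 0 <= gamma <= G -> sol gamma u ->
    (forall x, closure W x -> `|u x| <= C0) -> W x ->
    dotp (grad u x) v <= (K + D) * `|v|.
  move=> /andP[g0 gG] S HC Wx; have [->|v0] := eqVneq v 0.
    by rewrite dotp0 normr0 mulr0.
  have [T [T0 WT cT [GT|GT]]] := interior_ray annW Wx v0.
    rewrite (le_trans (HK _ _ _ _ _ S HC T0 WT GT cT))//.
    by rewrite ler_wpM2r// lerDl.
  have cx := subset_closure Wx.
  have WT' (s : R) : 0 < s < T -> W (x + s *: v).
    by move=> /andP[s0 sT]; apply: WT; rewrite (ltW s0).
  set y := x + T *: v in cT GT.
  have h1 := sol_supporting_rev annW S T0 cT WT'.
  have h2 := sol_supporting annW S cx T0 WT'.
  rewrite (grad_closure_in (sol_C1 S) Wx) -/y in h1 h2.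
  have {h1 h2} : dotp (grad u x) v <= dotp (grad_closure W u y) v.
    rewrite -(ler_pM2l T0); move: h1 h2; clear.
    by move: (u x) (u y) (T * dotp (grad _ _) _) (T * dotp _ _) => a b c e; lra.
  move=> /le_trans; apply.
  (* [v] is written as [(v + a nu) - a nu]. This [a] makes the first part point strictly outwards,
     so [inner_slope] applies to it; the boundary condition gives the slope of the second. *)
  pose a := `|dotp (nu y) v| + `|v|; have nv0 : 0 < `|v| by rewrite normr_gt0.
  have a0 : 0 <= a by rewrite addr_ge0.
  have nn := norm_normal annW GT.
  have an : a <= (n%:R + 1) * `|v|.
    rewrite mulrDl mul1r lerD2r (le_trans (ler_norm_dotp _ _))// ler_wpM2l//.
    by rewrite ler_piMl.
  have pos : 0 < dotp (nu y) (v + a *: nu y).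
    rewrite dotpDr dotpZr (normal1 annW GT) mulr1 /a addrA ltr_wpDl//.
    by rewrite addrC -lerBlDr sub0r -normrN ler_norm.
  have := Hd C0 gamma u y _ S HC GT pos.
  rewrite dotpDr dotpZr (sol_inner S GT) -lerBrDr => /le_trans; apply.
  have n1 : `|v + a *: nu y| <= (n%:R + 2) * `|v|.
    rewrite (le_trans (ler_normD _ _))// normrZ ger0_norm//.
    have : a * `|nu y| <= a by rewrite ler_piMr.
    by move: an; clear; move: (a * _) => b; lra.
  have n2 : - (gamma * u y + phi y) <= G * C0 + P.
    rewrite (le_trans (ler_norm _))// normrN (le_trans (ler_normD _ _))// lerD//.
      by rewrite normrM ger0_norm//; apply: ler_pM => //; exact: HC.
    exact: phiP.
  have n3 : - (a * (gamma * u y + phi y)) <= (n%:R + 1) * `|v| * (G * C0 + P).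
    rewrite -mulrN (le_trans (ler_wpM2l a0 n2))// ler_wpM2r//.
    by rewrite addr_ge0// mulr_ge0.
  have n4 : C0 / d * `|v + a *: nu y| <= C0 / d * ((n%:R + 2) * `|v|).
    by rewrite ler_wpM2l// divr_ge0// ltW.
  have -> : (K + D) * `|v| = K * `|v| + (C0 / d * ((n%:R + 2) * `|v|) +
      (n%:R + 1) * `|v| * (G * C0 + P)) by rewrite /D; ring.
  by rewrite ler_wpDl ?mulr_ge0// lerD.
exists (K + D) => [|gamma u x v gG S HC cx]; first exact: addr_ge0.
apply/ler_addgt0Pr => e e0.
have K1 : 0 < n%:R * `|v| + 1 by rewrite ltr_wpDl// mulr_ge0.
have [r r0 rg] := grad_closure_near (sol_C1 S) cx (divr_gt0 e0 K1).
have [y Wy yx] := (closure_norm _ _).2 cx _ r0.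
apply: (@le_trans _ _ (dotp (grad u y) v + e)).
  by apply: dotp_le_near; rewrite distrC; exact: rg.
by rewrite lerD2r; exact: in_bound gG S HC Wy.
Qed.

End A_priori_estimates.

(** * Euclidean form of the gradient bound, and conclusion *)

Lemma enorm_le (R : realType) (n : nat) (g : 'rV[R]_n) (C : R) : 0 <= C ->
  dotp g g <= C * `|g| -> enorm g <= C.
Proof.
move=> C0 gC; have [->|g0] := eqVneq g 0; first by rewrite /enorm dotp0 sqrtr0.
have e0 := enorm_gt0 g0; have gg : enorm g ^+ 2 = dotp g g.
  by rewrite sqr_sqrtr ?dotp_ge0.
have ng : `|g| <= enorm g.
  by rewrite -(@ler_pXn2r _ 2) ?nnegrE ?(ltW e0)// gg sqr_norm_le_dotp.
rewrite -(ler_pM2r e0) -expr2 gg (le_trans gC)//.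
exact: ler_wpM2l.
Qed.

Theorem theorem1p1 (R : realType) (n : nat) (hn : (2 <= n)%N)
    (Omega Gp Gm : set 'rV[R]_n) (hOmega : annular_domain Omega Gp Gm)
    (nu : 'rV[R]_n -> 'rV[R]_n)
    (hnu : forall x, Gm x -> inner_unit_normal Omega x (nu x))
    (psi : 'rV[R]_n -> R) (psi_smooth : smooth Omega psi)
    (psi_gt0 : forall x, Omega x -> 0 < psi x)
    (phi : 'rV[R]_n -> R) (phi_smooth : smooth_along Gm phi) :
  exists C0 C1 : R,
    forall (gamma0 : R) (u : 'rV[R]_n -> R),
      0 <= gamma0 ->
      Ck 2 Omega u ->
      C1_closure Omega u ->
      strictly_convex_on Omega u ->
      (forall x, Omega x -> \det (hessian u x) = psi x ^+ n) ->
      (forall x, Gp x -> u x = 0) ->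
      (forall x, Gm x ->
         dotp (grad_closure Omega u x) (nu x) = gamma0 * u x + phi x) ->
      (sup_norm (closure Omega) u <= C0%:E)%E /\
      (C1_norm Omega u <= C1%:E)%E.

Proof.
have [Dp [Dm [annW -> ->]]] := annular_domain_annulus hOmega hnu.
have [[gamma0 [w [g0 Sw]]]|nosol] := pselect (exists gamma0 w,
    0 <= gamma0 /\ solution Omega Dp Dm nu psi phi gamma0 w); last first.
  exists 0, 0 => gamma u g0 C2 C1 su du Gpu Gmu; case: nosol.
  by exists gamma, u; split=> //; exact: Solution.
have [P P0 phiP] := phi_bound annW Sw.
have [M M0 WM] := annulus_norm annW.
have [L L0 HL] := lower_bound hn annW Sw.
have [G HG] := gamma_bound hn annW psi_smooth psi_gt0 phiP.
have G0 : 0 <= G := le_trans g0 (HG _ _ g0 Sw).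
pose U := n%:R * (M + M) * P.
have U0 : 0 <= U by rewrite !mulr_ge0// addr_ge0// ltW.
have C00 : 0 <= U + L := addr_ge0 U0 L0.
have [C C1_ge0 HC] := gradient_bound hn annW C00 P0 G0 Sw phiP.
exists (U + L), (U + L + C) => gamma u gamma_ge0 C2 C1 su du Gpu Gmu.
have S : solution Omega Dp Dm nu psi phi gamma u by exact: Solution.
have uC0 x : closure Omega x -> `|u x| <= U + L.
  move=> cx; rewrite ler_norml; apply/andP; split.
    by apply: le_trans (HL _ _ gamma_ge0 S _ cx); rewrite lerN2 lerDr.
  by rewrite (le_trans (upper_bound hn annW WM phiP gamma_ge0 S cx))// lerDl.
have sup_le : (sup_norm (closure Omega) u <= (U + L)%:E)%E.
  by apply: ge_ereal_sup => _ [x cx <-]; rewrite lee_fin; exact: uC0.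
split=> //; rewrite /C1_norm EFinD; apply: leeD => //.
(* The slope bound is used in the direction of the gradient itself. *)
apply: ge_ereal_sup => _ [x cx <-]; rewrite lee_fin; apply: enorm_le => //.
by apply: (HC gamma) => //; rewrite gamma_ge0 (HG _ u).
Qed.
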